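(* Let $\beta\in(0,\infty)$, $p\ge1$, and let $\xi=([0,L],(X_i)_{i\ge1},(P_i)_{i\ge1})$ be random such that $0\le X_i\le L$, $P_i\ge0$, $i\ge1$, $\mathbb E[L^p]<\infty$ and $\mathbb E[\sum_{j\ge1}P_j^{p\beta}]<1$. Let $(\check{\mathcal T}_0,(\check X^{(0)}_i)_{i\ge1},(\check P^{(0)}_i)_{i\ge1})=\xi$. For $n\ge0$, to obtain $(\check{\mathcal T}_{n+1},(\check X^{(n+1)}_i)_{i\ge1},(\check P^{(n+1)}_i)_{i\ge1})$ conditionally given the objects of stages $0,\dots,n$, attach to each $\check X_i^{(n)}\in\check{\mathcal T}_n$, $i\ge1$, an independent isometric copy of $\xi$ with metric rescaled by $(\check P^{(n)}_i)^\beta$ and atom masses rescaled by $\check P^{(n)}_i$. Then $$\lim_{n\to\infty}\check{\mathcal T}_n=\check{\mathcal T}\quad\text{a.s. in the Gromov-Hausdorff topology on }\mathbb T$$ for some random compact $\mathbb R$-tree $\check{\mathcal T}$.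
   Context: Trees. An $\mathbb R$-tree is a separable metric space $(T,d)$ in which any two points are joined by a unique injective path (up to reparametrisation), isometric to an interval of length their distance. All trees are rooted. $\mathbb T$ is the set of root-preserving isometry classes of compact rooted $\mathbb R$-trees, with the pointed Gromov-Hausdorff metric $d_{\rm GH}((T,d,\rho),(T',d',\rho'))=\inf\max\{\delta(\varphi(\rho),\varphi'(\rho')),\delta_{\rm H}(\varphi(T),\varphi'(T'))\}$, infimum over isometric embeddings $\varphi,\varphi'$ into a common metric space $(\mathcal M,\delta)$, $\delta_{\rm H}$ being Hausdorff distance. Construction. $L$ is a random variable in $(0,\infty)$ and the $X_i$ need not be distinct; no summability of $(P_i)$ is assumed. Attaching a copy of $\xi$ at $x$ means identifying its left endpoint $0$ with $x$ (disjoint union, path metric). $\check{\mathcal T}_{n+1}$ is $\check{\mathcal T}_n$ with all rescaled copies attached (one for each index $i$), rooted at the left endpoint of $\check{\mathcal T}_0=[0,L]$; $(\check X^{(n+1)}_i,\check P^{(n+1)}_i)_{i\ge1}$ is an enumeration of the locations and rescaled masses of all atoms of the newly attached copies. The copies used at all stages are independent of each other and of the past. *)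

(* Defs.v *)
From HB Require Import structures.
From mathcomp Require Import all_boot all_order all_algebra lra.
From mathcomp Require Import all_classical all_reals all_analysis.

Set Implicit Arguments.
Unset Strict Implicit.
Unset Printing Implicit Defensive.

Import Order.TTheory GRing.Theory Num.Theory.
Import numFieldTopology.Exports numFieldNormedType.Exports.

Local Open Scope classical_set_scope.
Local Open Scope ring_scope.

(* The atoms are indexed by [nat] instead of {1, 2, ...}. *)
Record bead_string (R : realType) := BeadString {
  len : R;
  loc : nat -> R;
  mass : nat -> R;
  len_gt0 : 0 < len;
  loc_itv : forall i, 0 <= loc i <= len;
  mass_ge0 : forall i, 0 <= mass i }.

Section bead_string_measurable.
Variable R : realType.

Lemma unit_loc_itv (i : nat) : 0 <= (0 : R) <= 1.
Proof. by rewrite lexx ler01. Qed.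

Definition massless_unit_string : bead_string R :=
  @BeadString R 1 (fun=> 0) (fun=> 0) ltr01 unit_loc_itv (fun=> lexx 0).

HB.instance Definition _ := gen_eqMixin (bead_string R).
HB.instance Definition _ := gen_choiceMixin (bead_string R).
HB.instance Definition _ := isPointed.Build (bead_string R) massless_unit_string.

Definition coordinate_events : set (set (bead_string R)) :=
  [set A | exists2 B : set R, measurable B &
     [\/ A = @len R @^-1` B,
         exists i, A = (fun s => loc s i) @^-1` B |
         exists i, A = (fun s => mass s i) @^-1` B]].

(* The product sigma-algebra, inherited from R * R^nat * R^nat. *)
HB.instance Definition _ := @isMeasurable.Build (sigma_display coordinate_events)
  (bead_string R) <<s coordinate_events >>
  (@sigma_algebra0 _ setT coordinate_events) (@sigma_algebraC _ coordinate_events)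
  (@sigma_algebra_bigcup _ setT coordinate_events).

End bead_string_measurable.

Record rooted_space (R : realType) := RootedSpace {
  carrier :> metricType R;
  root : carrier }.

Section real_trees.
Variables (R : realType) (T : metricType R).

Definition geodesic (x y : T) (f : R -> T) : Prop :=
  [/\ f 0 = x, f (mdist x y) = y &
      {in `[0, mdist x y] &, forall s t, mdist (f s) (f t) = `|s - t|}].

Definition injective_path (x y : T) (g : R -> T) : Prop :=
  [/\ g 0 = x, g 1 = y, {within `[0, 1], continuous g} &
      {in `[0, 1] &, injective g}].

Definition reparametrisation_of (l : R) (f g : R -> T) : Prop :=
  exists theta : R -> R,
    [/\ theta 0 = 0, theta 1 = l, {within `[0, 1], continuous theta},
        {in `[0, 1] &, {homo theta : s t / s < t}} &
        {in `[0, 1], forall s, g s = f (theta s)}].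

Definition is_real_tree : Prop :=
  (exists A : set T, countable A /\ dense A) /\
  forall x y : T, exists2 f, geodesic x y f &
    forall g, injective_path x y g -> reparametrisation_of (mdist x y) f g.

End real_trees.

Definition is_compact_real_tree (R : realType) (T : rooted_space R) : Prop :=
  is_real_tree T /\ compact [set: T].

(* Points of the space of isometry classes are handled through representatives:
   [gh_dist] does not depend on the choice of representatives, so that a
   [gh_open] set is the inverse image of an open set of isometry classes, and
   conversely. *)
Record compact_real_tree (R : realType) := CompactRealTree {
  tree :> rooted_space R;
  treeP : is_compact_real_tree tree }.

Definition hausdorff_dist (R : realType) (M : metricType R) (A B : set M) : \bar R :=
  ereal_inf [set e%:E | e in [set e : R | [/\ 0 < e,
    (forall a, A a -> exists2 b, B b & mdist a b < e) &
    (forall b, B b -> exists2 a, A a & mdist a b < e)]]].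

Definition isometric_embedding (R : realType) (S M : metricType R) (f : S -> M) :=
  forall x y, mdist (f x) (f y) = mdist x y.

Definition gh_dist (R : realType) (S T : rooted_space R) : \bar R :=
  ereal_inf [set r | exists (M : metricType R) (f : S -> M) (g : T -> M),
    [/\ isometric_embedding f, isometric_embedding g &
        r = maxe (mdist (f (root S)) (g (root T)))%:E
                 (hausdorff_dist (range f) (range g))]].

Definition gh_open (R : realType) (U : compact_real_tree R -> Prop) : Prop :=
  forall S, U S -> exists2 e : R, 0 < e &
    forall T : compact_real_tree R, (gh_dist S T < e%:E)%E -> U T.

(* Borel measurability for the Gromov-Hausdorff topology. *)
Definition random_tree (R : realType) d (Omega : measurableType d)
    (T : Omega -> compact_real_tree R) : Prop :=
  forall U, gh_open U -> measurable [set w | U (T w)].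

Definition segment (R : realType) (l : R) := {r : R | 0 <= r <= l}.

Section segment_metric.
Variables (R : realType) (l : R).

HB.instance Definition _ := Choice.on (segment l).

Definition segment_dist (s t : segment l) : R := `|val s - val t|.

Lemma segment_distxx s : segment_dist s s = 0.
Proof. by rewrite /segment_dist subrr normr0. Qed.

Lemma segment_dist_positivity s t : segment_dist s t = 0 -> s = t.
Proof. by move/eqP; rewrite normr_eq0 subr_eq0 => /eqP/val_inj. Qed.

Lemma segment_dist_sym s t : segment_dist s t = segment_dist t s.
Proof. exact: distrC. Qed.

Lemma segment_dist_triangle t s u :
  segment_dist s u <= segment_dist s t + segment_dist t u.
Proof. exact: ler_distD. Qed.

HB.instance Definition _ := isMetric.Build R (segment l)
  segment_distxx segment_dist_positivity segment_dist_sym segment_dist_triangle.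

End segment_metric.

(* The disjoint union of [T] and of the intervals [0, l i], where the left
   endpoint of the [i]-th interval is identified with [x i]: only ]0, l i] has to
   be added to [T] (nothing at all if [l i = 0]). *)
Definition glued (R : realType) (T : metricType R) (x : nat -> T) (l : nat -> R) :=
  (T + {i : nat & {r : R | 0 < r <= l i}})%type.

Section glued_metric.
Variables (R : realType) (T : metricType R) (x : nat -> T) (l : nat -> R).
Notation G := (glued x l).

HB.instance Definition _ := Choice.on G.

Definition old_point (a : T) : G := inl a.

(* The point at distance [r] from [x i] on the [i]-th interval, meaningful for
   [0 <= r <= l i]. *)
Definition new_point (i : nat) (r : R) : G :=
  if (insub r : option {r : R | 0 < r <= l i}) is Some r'
  then inr (existT _ i r') else inl (x i).

Definition glued_dist (u v : G) : R :=
  match u, v with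
  | inl a, inl b => mdist a b
  | inl a, inr (existT j s) => mdist a (x j) + val s
  | inr (existT i r), inl b => val r + mdist (x i) b
  | inr (existT i r), inr (existT j s) =>
      if i == j then `|val r - val s| else val r + mdist (x i) (x j) + val s
  end.

Lemma glued_distxx u : glued_dist u u = 0.
Proof.
by case: u => [a|[i r]] /=; rewrite ?mdistxx // eqxx subrr normr0.
Qed.

Lemma glued_dist_positivity u v : glued_dist u v = 0 -> u = v.
Proof.
case: u v => [a|[i [r r0]]] [b|[j [s s0]]] /=.
- by move/mdist_positivity ->.
- have := mdist_ge0 a (x j); case/andP: (s0) => s_gt0 _ ? ?; exfalso; lra.
- have := mdist_ge0 (x i) b; case/andP: (r0) => r_gt0 _ ? ?; exfalso; lra.
case: (eqVneq i j) s s0 => [<- s s0|_ s s0].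
  move/eqP; rewrite normr_eq0 subr_eq0 => /eqP rs.
  by congr (inr (existT _ _ _)); exact: val_inj.
have := mdist_ge0 (x i) (x j).
by case/andP: (r0) => r_gt0 _; case/andP: (s0) => s_gt0 _ ? ?; exfalso; lra.
Qed.

Lemma glued_dist_sym u v : glued_dist u v = glued_dist v u.
Proof.
case: u v => [a|[i r]] [b|[j s]] /=.
- exact: metric_sym.
- by rewrite metric_sym addrC.
- by rewrite metric_sym addrC.
by rewrite eq_sym metric_sym distrC; case: eqP => // _; lra.
Qed.

Lemma glued_dist_triangle v u w :
  glued_dist u w <= glued_dist u v + glued_dist v w.
Proof.
have tri (a b c : T) : mdist a c <= mdist a b + mdist b c by exact: metric_triangle.
have ab (a b : R) : 0 < a -> 0 < b -> `|a - b| <= a + b.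
  by move=> a0 b0; rewrite ler_norml; apply/andP; split; lra.
have abl (a b : R) : a <= `|a - b| + b by have := ler_norm (a - b); lra.
have abr (a b : R) : b <= a + `|a - b| by rewrite distrC addrC; exact: abl.
case: u v w => [a|[i [r /= /andP[r0 _]]]] [b|[j [s /= /andP[s0 _]]]]
  [c|[k [t /= /andP[t0 _]]]] /=.
- exact: tri.
- by have := tri a b (x k); lra.
- by have := tri a (x j) c; lra.
- case: eqVneq => [<-|_]; first by have := abr s t; lra.
  by have := tri a (x j) (x k); lra.
- by have := tri (x i) b c; lra.
- case: eqVneq => [_|_]; last by have := tri (x i) b (x k); lra.
  by have := ab _ _ r0 t0; have := mdist_ge0 (x i) b; have := mdist_ge0 b (x k); lra.
- case: eqVneq => [<-|_]; first by have := abl r s; lra.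
  by have := tri (x i) (x j) c; lra.
case: (eqVneq i j) => [<-|ij].
  case: eqVneq => [_|_]; first exact: ler_distD.
  by have := abl r s; lra.
case: (eqVneq j k) => [<-|jk]; first by rewrite (negbTE ij); have := abr s t; lra.
have := mdist_ge0 (x i) (x j); have := mdist_ge0 (x j) (x k).
case: eqVneq => [_|_]; first by have := ab _ _ r0 t0; lra.
by have := tri (x i) (x j) (x k); lra.
Qed.

HB.instance Definition _ := isMetric.Build R G
  glued_distxx glued_dist_positivity glued_dist_sym glued_dist_triangle.

End glued_metric.

Record beaded_space (R : realType) := BeadedSpace {
  beaded_rooted :> rooted_space R;
  atom_loc : nat -> beaded_rooted;
  atom_mass : nat -> R }.

Section construction.
Variables (R : realType) (beta : R).

Lemma zero_itv (xi : bead_string R) : 0 <= (0 : R) <= len xi.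
Proof. by rewrite lexx ltW// len_gt0. Qed.

Definition beaded_of_string (xi : bead_string R) : beaded_space R :=
  @BeadedSpace R
    (@RootedSpace R (segment (len xi)) (exist _ 0 (zero_itv xi)))
    (fun i => exist _ (loc xi i) (loc_itv xi i)) (mass xi).

(* [xi i] is attached at the [i]-th atom of [T]. The [k]-th atom of the result is
   the [j]-th atom of the copy [xi i], with [(i, j) = enum k]. *)
Definition attach (T : beaded_space R) (xi : nat -> bead_string R)
    (enum : nat -> nat * nat) : beaded_space R :=
  let scale i := atom_mass T i `^ beta in
  let x := @atom_loc R T in
  let l i := scale i * len (xi i) in
  @BeadedSpace R
    (@RootedSpace R (glued x l) (old_point x l (root T)))
    (fun k => let: (i, j) := enum k in new_point x l i (scale i * loc (xi i) j))
    (fun k => let: (i, j) := enum k in atom_mass T i * mass (xi i) j).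

(* [copy n i] is the string attached to the [i]-th atom of stage [n], and [enum n]
   is the enumeration of the atoms of stage [n.+1]. *)
Fixpoint stage (xi : bead_string R) (copy : nat -> nat -> bead_string R)
    (enum : nat -> nat -> nat * nat) (n : nat) : beaded_space R :=
  if n is m.+1 then attach (stage xi copy enum m) (copy m) (enum m)
  else beaded_of_string xi.

End construction.

Section copies.
Context (R : realType) (d : measure_display) (Omega : measurableType d).
Variables (P : probability Omega R) (xi : {mfun Omega >-> bead_string R}).
Variables (copy : nat -> nat -> {mfun Omega >-> bead_string R}).
Variables (enum : nat -> Omega -> nat -> nat * nat).

(* The events determined by the stages [0, ..., n]. *)
Definition past (n : nat) : set (set Omega) :=
  <<s [set A |
    [\/ exists2 E, measurable E & A = xi @^-1` E,
        exists m i, (m < n)%N /\ exists2 E, measurable E & A = copy m i @^-1` E |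
        exists m k q, (m < n)%N /\ A = [set w | enum m w k = q]]] >>.

(* The enumerations may be random (e.g. depend on the atoms to be enumerated). *)
Definition random_enumerations : Prop :=
  (forall n w, bijective (enum n w)) /\
  (forall n k q, measurable [set w | enum n w k = q]).

Definition fresh_copies : Prop :=
  (forall n i E, measurable E -> P (copy n i @^-1` E) = P (xi @^-1` E)) /\
  (forall n A N (E : nat -> set (bead_string R)), past n A ->
    (forall i, measurable (E i)) ->
    (P (A `&` \big[setI/setT]_(i < N) (copy n i @^-1` E i)) =
     P A * \prod_(i < N) P (copy n i @^-1` E i))%E).

End copies.

(* Main.v *)
(* A metric space is a real tree as soon as it satisfies the four-point condition and
   any two points have a point between them at each intermediate distance: the
   Gromov product with the endpoints of a geodesic is locally constant off the
   geodesic, so that an injective path must run through exactly its points.  Both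
   properties are preserved by grafting branches and by compact completions.

   With m = E[sum_j P_j^(p beta)] < 1, the lengths l of the branches grafted on stage
   n satisfy E[sum l^p] = m^(n+1) E[L^p].  For m < r < 1 the sum of these lengths
   to the power p is thus almost surely O(r^n), so that the lengths of one stage
   tend to 0 and are at most C rho^n, with rho = r^(1/p).  Hence all the stages are
   compact and lie, up to O(rho^n), densely in the completion of their union, which
   is the limit.

   The limit is a measurable function of w because the distances between the
   elements of a dense sequence of points are: knowing up to e the distances between
   the points of a finite e-net determines the tree up to O(e). *)

Require Import Defs.
From HB Require Import structures.
From mathcomp Require Import all_boot all_order all_algebra ring lra.
From mathcomp Require Import all_classical all_reals all_analysis measurable_realfun.

Import Order.TTheory GRing.Theory Num.Theory.
Import numFieldTopology.Exports numFieldNormedType.Exports.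

Local Open Scope classical_set_scope.
Local Open Scope ring_scope.

Set Implicit Arguments.
Unset Strict Implicit.
Unset Printing Implicit Defensive.

(** * Real trees and the four-point condition *)

(** The masses of a stage need not be summable, so the total length grafted on it may be infinite,
    and the moments of order [p] control only its longest branch. This is enough: a point grafted
    after stage n is reached from stage n through at most one branch of each later stage, hence
    along a geometric series.

    All the almost sure information is put into one random variable, the sum over n of r^(-n) times
    the sum of the p-th powers of the lengths grafted on stage n. Where it is finite, it gives both
    the decay within each stage and the geometric bound across the stages. As it is measurable, so
    is the event on which it is finite; off this event the limit is set to a fixed tree.

    The carriers of the stages depend on [w], so a random point of a stage is not a random variable.
    Points are therefore named by codes that do not depend on [w], and only the distances between
    codes are random variables. The same codes index the completion, whose points are functions on
    codes; the union of the stages is thus never formed as a type. *)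

Section real_tree_criterion.
Context {R : realType}.
Implicit Types T : metricType R.

(** The bound of one sum by the maximum of the two others; the maximum is written as a disjunction,
    which [lra] can exploit. *)
Definition four_point T := forall a b c e : T,
  mdist a b + mdist c e <= mdist a c + mdist b e \/
  mdist a b + mdist c e <= mdist a e + mdist b c.

Definition has_between T := forall (x y : T) (s : R), 0 <= s <= mdist x y ->
  exists2 z, mdist x z = s & mdist z y = mdist x y - s.

Definition tree_like T := four_point T /\ has_between T.

Lemma near_mdist T (x : T) e : 0 < e -> \forall y \near x, mdist x y < e.
Proof. by move=> e0; have := @nbhsx_ballx _ _ x _ e0; rewrite ballEmdist; apply. Qed.

(** Points chosen independently at each distance from [x] already form an isometric curve: the
    four-point condition with [x] and [y] bounds the distance of two of them by the difference of
    their parameters. *)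
Lemma has_between_geodesic T (x y : T) : tree_like T -> exists f, geodesic x y f.
Proof.
move=> [fp hb].
have H (s : R) : exists z, 0 <= s <= mdist x y -> mdist x z = s /\ mdist z y = mdist x y - s.
  have [/hb[z xz zy]|h] := boolP (0 <= s <= mdist x y); first by exists z.
  by exists x.
have [f fP] := choice H.
have le (s t : R) : 0 <= s -> s <= t -> t <= mdist x y -> mdist (f s) (f t) = t - s.
  move=> s0 st tl.
  have [|xs sy] := fP s; first by apply/andP; split; lra.
  have [|xt ty] := fP t; first by apply/andP; split; lra.
  have := metric_triangle x (f s) (f t).
  have := fp (f s) (f t) x y.
  by rewrite !(metric_sym _ x) (metric_sym (f s)) => -[]; lra.
exists f; split.
- have [|x0 _] := fP 0; first by rewrite lexx mdist_ge0.
  exact/esym/mdist_positivity.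
- have [|_ y0] := fP (mdist x y); first by rewrite lexx mdist_ge0.
  by apply: mdist_positivity; rewrite y0 subrr.
- move=> s t; rewrite !in_itv/= => /andP[s0 sl] /andP[t0 tl].
  have [st|/ltW ts] := leP s t.
    by rewrite le// ler0_norm; lra.
  by rewrite metric_sym le// ger0_norm; lra.
Qed.

(** The Gromov product of [y] and [z] seen from [x]: in a tree, the distance from [x] to the point
    of the geodesic from [x] to [y] that is nearest to [z]. *)
Definition projection {T} (x y z : T) : R := (mdist x z + mdist x y - mdist z y) / 2.

Lemma projection_continuous T (x y : T) : continuous (projection x y).
Proof.
move=> z; apply/cvgrPdist_lt => e /(near_mdist z) ze; near=> u.
have : mdist z u < e by near: u.
have := metric_triangle x z u; have := metric_triangle x u z.
have := metric_triangle z u y; have := metric_triangle u z y.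
rewrite (metric_sym u z) /projection ltr_norml => ? ? ? ? ?.
by apply/andP; split; lra.
Unshelve. all: by end_near. Qed.

Lemma projection_itv T (x y z : T) : 0 <= projection x y z <= mdist x y.
Proof.
have := metric_triangle x y z; have := metric_triangle z x y; have := metric_triangle x z y.
by rewrite (metric_sym y z) (metric_sym z x) /projection => ? ? ?; apply/andP; split; lra.
Qed.

(** If [m] is the foot of [z] on the geodesic, leaving the branch that carries [z] requires passing
    through [m]; the ball around [z] of radius [mdist z m] therefore projects to the same foot. *)
Lemma projection_near T (x y z m : T) : four_point T ->
  mdist x m = projection x y z -> mdist m y = mdist x y - projection x y z ->
  z != m -> \forall z' \near z, projection x y z' = projection x y z.
Proof.
move=> fp xm my; rewrite -mdist_gt0 => zm.
near=> z'; have : mdist z z' < mdist z m by near: z'; exact: near_mdist.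
(* A detour through [z] costs at least twice its height above [m]. *)
have h : mdist x z + mdist z y >= mdist x y + 2 * mdist z m.
  have := fp z m x y; rewrite (metric_sym z x) (metric_sym m x) xm my /projection.
  by case=> ?; lra.
rewrite /projection; have := fp x z z' y; have := fp x z' z y; have := fp x y z z'.
have := metric_triangle x z' z; have := metric_triangle z z' y; have := mdist_ge0 z z'.
rewrite (metric_sym z' z) (metric_sym y z) (metric_sym y z').
by move=> ? ? ? [] ? [] ? [] ? ?; lra.
Unshelve. all: by end_near. Qed.

Lemma continuous_locally_constant (T : topologicalType) (h : R -> T) (P : set T) :
  continuous h -> (forall t, P (h t) -> \forall z \near h t, P z) ->
  (forall t, ~ P (h t) -> \forall z \near h t, ~ P z) ->
  forall t u, P (h t) -> P (h u).
Proof.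
move=> hc op cl t u Pt.
have /connected_intervalP : is_interval [set: R] by [].
move=> /(_ (h @^-1` P)) E.
suff : [set: R] `<=` h @^-1` P by apply.
rewrite E //; first by exists t.
  exists (h @^-1` P); rewrite ?setTI//.
  by rewrite openE => v /= /op /hc.
exists (h @^-1` P); rewrite ?setTI//.
by rewrite -[X in closed X]setCK; apply: open_closedC; rewrite openE => v /= /cl /hc.
Qed.

(** Along a path that avoids [m], having projection [s] is an open condition by [projection_near],
    and so is its negation by continuity; the line is connected. *)
Lemma projection_constant T (x y m : T) (h : R -> T) s : four_point T ->
  mdist x m = s -> mdist m y = mdist x y - s ->
  continuous h -> (forall t, h t <> m) ->
  forall t u, projection x y (h t) = s -> projection x y (h u) = s.
Proof.
move=> fp xm my hc hm.
apply: (@continuous_locally_constant _ h [set z | projection x y z = s]) => //= t ts.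
  rewrite -ts; apply: (@projection_near _ _ _ _ m) => //; rewrite ?ts//.
  exact/eqP/hm.
have := @projection_continuous T x y (h t).
by move=> /(_ [set r | r <> s]) /=; apply; apply: open_nbhs_nbhs; split => //;
  rewrite (_ : mkset _ = [set r | r != s]) //; apply/seteqP; split => r /eqP.
Qed.

(** Retracts the line onto [[a, b]]. Composed with it, a path on an interval becomes a path on the
    whole line, to which [projection_constant] applies. *)
Definition clip (a b t : R) := Num.max a (Num.min b t).

Lemma clip_itv (a b t : R) : a <= b -> clip a b t \in `[a, b].
Proof. by move=> ab; rewrite in_itv/= /clip le_max lexx ge_max ab ge_min lexx. Qed.

Lemma clip_id (a b t : R) : t \in `[a, b] -> clip a b t = t.
Proof. by rewrite in_itv/= => /andP[ta tb]; rewrite /clip min_r// max_r. Qed.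

Lemma clip_continuous (a b : R) : continuous (clip a b).
Proof.
move=> t; apply: continuous_max; first exact: cvg_cst.
by apply: continuous_min; [exact: cvg_cst|exact: cvg_id].
Qed.

Lemma continuous_clip (U : topologicalType) (g : R -> U) (a b : R) : a <= b ->
  {within `[a, b], continuous g} -> continuous (g \o clip a b).
Proof.
move=> ab /subspace_continuousP gc t.
have /gc : `[a, b]%classic (clip a b t) by exact: clip_itv.
move=> gt A /gt /=; rewrite /within/= => nA.
have := @clip_continuous a b t _ nA; rewrite /= !near_simpl.
by apply: filterS => u; apply; exact: clip_itv.
Qed.

Lemma within_continuous_sub (U : topologicalType) (g : R -> U) (a b c e : R) :
  c <= a -> b <= e ->
  {within `[c, e], continuous g} -> {within `[a, b], continuous g}.
Proof.
move=> ca be; apply: continuous_subspaceW => t /=; rewrite !in_itv/= => /andP[? ?].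
by apply/andP; split; lra.
Qed.

(** The change of parameter is the projection of [g t] on the geodesic. Once [g] is known to stay on
    the geodesic, this map is continuous and injective, hence increasing. *)
Lemma injective_path_reparametrisation T (x y : T) f g : four_point T ->
  geodesic x y f -> injective_path x y g -> reparametrisation_of (mdist x y) f g.
Proof.
move=> fp [f0 f1 fi] [g0 g1 gc gi].
have l0 : 0 <= mdist x y := mdist_ge0 x y.
pose pr := projection x y.
have prx : pr x = 0 by rewrite /pr /projection mdistxx; lra.
have pry : pr y = mdist x y by rewrite /pr /projection mdistxx; lra.
have xf (s : R) : 0 <= s <= mdist x y -> mdist x (f s) = s /\ mdist (f s) y = mdist x y - s.
  move=> /andP[s0 sl]; rewrite -{1}f0 -{1}f1 !fi ?in_itv/= ?lexx ?s0 ?sl ?l0//.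
  by rewrite sub0r normrN ger0_norm// distrC ger0_norm ?subr_ge0.
have avoid (a b : R) (s : R) : 0 <= a -> a <= b -> b <= 1 -> 0 <= s <= mdist x y ->
    (forall t, t \in `[a, b] -> g t <> f s) ->
    forall t u, t \in `[a, b] -> u \in `[a, b] -> pr (g t) = s -> pr (g u) = s.
  move=> a0 ab b1 /xf[xs sy] gs t u tab uab.
  have := @projection_constant _ x y (f s) (g \o clip a b) s fp xs sy _ _ t u.
  rewrite /= !clip_id//; apply.
    by apply: continuous_clip => //; apply: within_continuous_sub gc.
  by move=> v; apply: gs; exact: clip_itv.
have I0 : (0 : R) \in `[0, 1] by rewrite in_itv/= lexx ler01.
have I1 : (1 : R) \in `[0, 1] by rewrite in_itv/= lexx ler01.
have prg t : g t = f (pr (g t)) \/ t \notin `[0, 1].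
  have [tI|] := boolP (t \in `[0, 1]); last by right.
  left; apply: contrapT => gt.
  have := projection_itv x y (g t); rewrite -/pr; set s := pr (g t) in gt *; move=> sI.
  move: (tI); rewrite in_itv/= => /andP[t0 t1].
  (* Suppose that [g t] is off its foot [f s]. By injectivity [g] visits [f s] at most once, at some
     [t'] distinct from [t], so the part of the path from [t] to the end away from [t'] avoids [f s]
     and keeps projection [s]. That end is then [f s], a second visit. If there is no visit, the
     same argument on [[0, 1]] shows that [g 0] is one. *)
  have [[t' t'I gt']|hit] := pselect (exists2 t', t' \in `[0, 1] & g t' = f s).
    move: (t'I); rewrite in_itv/= => /andP[t'0 t'1].
    have tt' : t' != t by apply: contra_notN gt => /eqP <-.
    have [lt|lt|/eqP] := ltgtP t' t; last by rewrite (negbTE tt').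
      have := fun h => @avoid t 1 s t0 t1 (lexx 1) sI h t 1.
      rewrite !in_itv/= !lexx t1 g1 pry => H; apply/negP: (lt_le_trans lt t1).
      rewrite -leNgt; suff -> : t' = 1 by [].
      apply: (gi) => //; rewrite gt' g1 -[RHS]f1 H// => v.
      rewrite in_itv/= => /andP[tv v1] gv.
      have vt' : v = t' by apply: gi; rewrite ?gv ?gt'// in_itv/= v1 (le_trans t0).
      by move: lt; rewrite -vt' ltNge tv.
    have := fun h => @avoid 0 t s (lexx 0) t0 t1 sI h t 0.
    rewrite !in_itv/= !lexx t0 g0 prx => H; apply/negP: (le_lt_trans t0 lt).
    rewrite -leNgt; suff -> : t' = 0 by [].
    apply: (gi) => //; rewrite gt' g0 -[RHS]f0 H// => v.
    rewrite in_itv/= => /andP[v0 vt] gv.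
    have vt' : v = t' by apply: gi; rewrite ?gv ?gt'// in_itv/= v0 (le_trans vt).
    by move: lt; rewrite -vt' ltNge vt.
  have H u : u \in `[0, 1] -> pr (g u) = s.
    move=> uI; apply: (@avoid 0 1 s _ _ _ _ _ t u) => // v vI gv.
    by apply: hit; exists v.
  apply: hit; exists 0 => //; rewrite -(H 0)// g0 prx f0 //.
have prgc : {within `[0, 1], continuous (pr \o g)}.
  by apply: within_continuous_comp gc => z _; exact: projection_continuous.
exists (pr \o g); split => /=.
- by rewrite g0.
- by rewrite g1.
- exact: prgc.
- have ginj : {in `[0, 1] &, injective (pr \o g)}.
    move=> s t sI tI /= st; apply: gi => //.
    by have [->|] := prg s; [have [->|] := prg t; rewrite ?tI ?st|rewrite sI].
  have : {in `[0, 1] &, {mono pr \o g : s t / s <= t}}.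
    apply: segment_continuous_inj_le => //=; first by rewrite g0 g1 prx pry.
  by move=> /leW_mono_in h s t sI tI st; rewrite h.
- by move=> t tI; have [|] := prg t; rewrite ?tI.
Qed.

End real_tree_criterion.

(** * Compactness *)

Section compact_metric.
Context {R : realType}.
Implicit Types T : metricType R.

(** A copy of [T] with base point [x], for [compact_second_countable]. *)
Definition pointed_at T (x : T) : Type := T.

HB.instance Definition _ T (x : T) := Metric.on (pointed_at x).
HB.instance Definition _ T (x : T) := isPointed.Build (pointed_at x) x.

Lemma compact_separable T (x : T) : compact [set: T] ->
  exists A : set T, countable A /\ dense A.
Proof.
move=> /(@compact_second_countable R (pointed_at x))[B cB [Bo Bb]].
have H (U : set T) : exists y, U !=set0 -> U y.
  by have [[y Uy]|n] := pselect (U !=set0); [exists y|exists x].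
have [f fP] := choice H.
exists (f @` B); split; first exact: card_le_trans (card_image_le _ _) cB.
move=> V V0 Vo; have [y Vy] := V0.
have /Bb[U [BU Uy] UV] : nbhs y V by exact: open_nbhs_nbhs.
by exists (f U); split; [apply: UV; apply: fP; exists y|exists U].
Qed.

Lemma compact_tree_like (T : rooted_space R) : tree_like T -> compact [set: T] ->
  is_compact_real_tree T.
Proof.
move=> tT cT; split=> //; split; first exact: (compact_separable (Defs.root T)).
move=> x y; have [f gf] := has_between_geodesic x y tT.
exists f => // g; apply: injective_path_reparametrisation => //.
by case: tT.
Qed.

(** A cluster point of the image ultrafilter is a limit, because the ultrafilter contains the
    preimage of each ball or of its complement. *)
Lemma ultra_near_compact (X : Type) (U : set_system X) T (C : set T) (h : X -> T) :
  UltraFilter U -> compact C -> U (h @^-1` C) ->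
  exists2 c, C c & forall e : R, 0 < e -> U [set x | mdist c (h x) < e].
Proof.
move=> UF cC UC; have [c [Cc cl]] := cC (h @ U) _ UC.
exists c => // e e0.
have [//|Un] := in_ultra_setVsetC [set x | mdist c (h x) < e] UF.
by have [y [/= ny]] := cl [set y | ~ mdist c y < e] _ Un (near_mdist c e0).
Qed.

(** Completeness and total boundedness, with compact sets in place of finite nets: the image of an
    ultrafilter by [h e] converges in [C e], so the ultrafilter is Cauchy. *)
Lemma compact_nets T (C : R -> set T) (h : R -> T -> T) :
  (forall F : set_system T, UltraFilter F ->
     (forall e : R, 0 < e -> exists c, F [set x | mdist c x < e]) ->
     exists x : T, F --> x) ->
  (forall e, 0 < e -> compact (C e)) ->
  (forall e x, 0 < e -> C e (h e x) /\ mdist x (h e x) <= e) ->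
  compact [set: T].
Proof.
move=> cpl cC hC; rewrite compact_ultra => F UF _.
have [e e0|x Fx] := cpl F UF; last by exists x.
have e20 : 0 < e / 2 by rewrite divr_gt0.
have [c _ Fc] := @ultra_near_compact _ F _ (C (e / 2)) (h (e / 2)) UF (cC _ e20)
  (filterE _ (fun x => (hC _ x e20).1)).
exists c; apply: filterS (Fc _ e20) => x /= cx.
have := (hC _ x e20).2; have := metric_triangle c (h (e / 2) x) x.
by rewrite (metric_sym x (h _ x)); lra.
Qed.

(** Otherwise the sets of points missed by the first balls generate a proper filter, and its cluster
    point is close to no [u i]. *)
Lemma compact_finite_net T (u : nat -> T) (e : R) : compact [set: T] ->
  (forall x (e : R), 0 < e -> exists i, mdist (u i) x < e) -> 0 < e ->
  exists N, forall x, exists2 i, (i <= N)%N & mdist (u i) x < e.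
Proof.
move=> cT du e0; apply: contrapT => no.
pose B N := [set x | forall i, (i <= N)%N -> ~ mdist (u i) x < e].
have BF : ProperFilter (filter_from [set: nat] B).
  apply: filter_from_proper; first apply: filter_from_filter; first by exists 0%N.
    move=> i j _ _; exists (maxn i j) => // x Bx.
    by split=> k kl; apply: Bx; rewrite (leq_trans kl)// ?leq_maxl ?leq_maxr.
  move=> N _; apply: contrapT => NB; apply: no; exists N => x.
  apply: contrapT => nx; apply: NB; exists x => i iN ux.
  by apply: nx; exists i.
have [x [_ clx]] := cT _ BF (@filterT _ _ _).
have e20 : 0 < e / 2 by rewrite divr_gt0.
have [i ui] := du x _ e20.
have [] := clx (B i) [set y | mdist x y < e / 2].
- by exists i.
- exact: near_mdist.
move=> y [/(_ i (leqnn _)) nuy /= xy]; apply: nuy.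
have := metric_triangle (u i) x y; lra.
Qed.

Lemma isometric_continuous T T' (f : T -> T') : isometric_embedding f -> continuous f.
Proof.
move=> fi x; apply/metricType_numDomainType.cvgrPdist_lt => e /(near_mdist x).
by apply: filterS => y; rewrite fi.
Qed.

End compact_metric.

Section segment.
Context {R : realType}.
Variable l : R.
Hypothesis l0 : 0 <= l.

Lemma mdist_segment (s t : segment l) : mdist s t = `|val s - val t|.
Proof. by []. Qed.

Definition segment_point (t : R) : segment l := exist _ (clip 0 l t) (clip_itv t l0).

Lemma val_segment_point t : 0 <= t <= l -> val (segment_point t) = t.
Proof. by move=> tl /=; rewrite clip_id. Qed.

Lemma segment_pointK (s : segment l) : segment_point (val s) = s.
Proof. by apply: val_inj; rewrite val_segment_point//; exact: (valP s). Qed.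

Lemma four_point_line (a b c e : R) :
  `|a - b| + `|c - e| <= `|a - c| + `|b - e| \/
  `|a - b| + `|c - e| <= `|a - e| + `|b - c|.
Proof.
case: (ler0P (a - b)); case: (ler0P (c - e)); case: (ler0P (a - c)); case: (ler0P (b - e));
case: (ler0P (a - e)); case: (ler0P (b - c)); intros; first [left; lra | right; lra].
Qed.

Lemma segment_tree_like : tree_like (segment l).
Proof.
split; first by move=> a b c e; rewrite !mdist_segment; exact: four_point_line.
have le (x y : segment l) (s : R) : val x <= val y -> 0 <= s <= mdist x y ->
    exists2 z, mdist x z = s & mdist z y = mdist x y - s.
  have /andP[x0 xl] := valP x; have /andP[y0 yl] := valP y.
  move=> xy; rewrite !mdist_segment [`|_ - _|]distrC ger0_norm ?subr_ge0// => /andP[s0 sl].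
  have zl : 0 <= val x + s <= l by apply/andP; split; lra.
  exists (segment_point (val x + s)); rewrite mdist_segment val_segment_point//.
    by rewrite distrC ger0_norm; lra.
  by rewrite distrC ger0_norm; lra.
move=> x y s sd; have [xy|/ltW yx] := leP (val x) (val y); first exact: le.
have [|z yz zx] := @le y x (mdist x y - s) yx.
  by rewrite (metric_sym y); move/andP: sd => [? ?]; apply/andP; split; lra.
exists z; rewrite metric_sym ?yz//.
by rewrite zx (metric_sym y); lra.
Qed.

Lemma segment_compact_space : compact [set: segment l].
Proof.
have -> : [set: segment l] = segment_point @` `[0, l].
  apply/seteqP; split => // s _; exists (val s); last exact: segment_pointK.
  exact: (valP s).
apply: continuous_compact; last exact: segment_compact.
apply: continuous_subspaceT => t; rewrite /continuous_at.
apply/metricType_numDomainType.cvgrPdist_lt => e e0.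
have /cvgrPdist_lt /(_ e e0) := @clip_continuous R 0 l t.
by apply: filterS => u; rewrite mdist_segment.
Qed.

End segment.

(** * Grafting branches *)

Section glued_tree.
Context {R : realType}.
Variables (T : metricType R) (x : nat -> T) (l : nat -> R).
Notation G := (glued x l).
Notation old := (old_point x l).
Notation new := (new_point x l).

Lemma mdist_old (a b : T) : mdist (old a) (old b) = mdist a b.
Proof. by []. Qed.

Lemma new_point0 i : new i 0 = old (x i).
Proof. by rewrite /new_point insubN// ltxx. Qed.

Lemma new_pointE i (r : R) (h : 0 < r <= l i) : new i r = inr (existT _ i (exist _ r h)).
Proof. by rewrite /new_point insubT. Qed.

Lemma glued_cases (u : G) :
  (exists a, u = old a) \/ exists i r, 0 < r <= l i /\ u = new i r.
Proof.
case: u => [a|[i [r h]]]; first by left; exists a.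
by right; exists i, r; split => //; rewrite (new_pointE h).
Qed.

Lemma mdist_old_new a i (r : R) : 0 <= r <= l i ->
  mdist (old a) (new i r) = mdist a (x i) + r.
Proof.
move=> /andP[]; rewrite le_eqVlt => /predU1P[<- _|r0 rl].
  by rewrite new_point0 addr0.
have h : 0 < r <= l i by rewrite r0.
by rewrite (new_pointE h).
Qed.

Lemma mdist_new_old a i (r : R) : 0 <= r <= l i ->
  mdist (new i r) (old a) = mdist a (x i) + r.
Proof. by move=> h; rewrite metric_sym mdist_old_new. Qed.

Lemma mdist_new_same i (r s : R) : 0 <= r <= l i -> 0 <= s <= l i ->
  mdist (new i r) (new i s) = `|r - s|.
Proof.
move=> /andP[]; rewrite le_eqVlt => /predU1P[<- l0|r0 rl].
  move=> sl; rewrite new_point0 mdist_old_new// mdistxx add0r sub0r normrN ger0_norm//.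
  by case/andP: sl.
have h : 0 < r <= l i by rewrite r0.
move=> /andP[]; rewrite le_eqVlt => /predU1P[<- l0|s0 sl].
  by rewrite new_point0 metric_sym mdist_old_new ?(ltW r0)// mdistxx add0r subr0 gtr0_norm.
have h' : 0 < s <= l i by rewrite s0.
by rewrite (new_pointE h) (new_pointE h') /mdist/= eqxx.
Qed.

Lemma mdist_new_diff i j (r s : R) : i != j -> 0 <= r <= l i -> 0 <= s <= l j ->
  mdist (new i r) (new j s) = r + mdist (x i) (x j) + s.
Proof.
move=> ij /andP[]; rewrite le_eqVlt => /predU1P[<- l0|r0 rl].
  by move=> sl; rewrite new_point0 mdist_old_new// add0r.
have h : 0 < r <= l i by rewrite r0.
move=> /andP[]; rewrite le_eqVlt => /predU1P[<- l0|s0 sl].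
  by rewrite new_point0 metric_sym mdist_old_new ?(ltW r0)// metric_sym addr0 addrC.
have h' : 0 < s <= l j by rewrite s0.
by rewrite (new_pointE h) (new_pointE h') /mdist/= (negbTE ij).
Qed.

Definition base (u : G) : T := match u with inl a => a | inr (existT i _) => x i end.
Definition height (u : G) : R := match u with inl _ => 0 | inr (existT _ r) => val r end.
Definition on_branch i (u : G) : bool :=
  match u with inl _ => false | inr (existT j _) => j == i end.

Lemma height_ge0 u : 0 <= height u.
Proof. by case: u => [//|[i [r /= /andP[/ltW]]]]. Qed.

Lemma mdist_off u v : (forall i, on_branch i u -> ~~ on_branch i v) ->
  mdist u v = height u + mdist (base u) (base v) + height v.
Proof.
case: u v => [a|[i r]] [b|[j s]] H; rewrite /mdist/=.
- by rewrite add0r addr0.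
- by rewrite add0r.
- by rewrite addr0.
by move: (H i); rewrite /= eqxx eq_sym => /(_ isT)/negbTE ->.
Qed.

(* Measures positions along the [i]-th branch; outside of the branch it is minus
   the distance to the branching point, so that it is an isometry on pairs of
   points one of which is on the branch. *)
Definition position i (u : G) : R :=
  if on_branch i u then height u else - mdist (old (x i)) u.

Lemma mdist_on_on i u v : on_branch i u -> on_branch i v ->
  mdist u v = `|position i u - position i v|.
Proof.
rewrite /position; case: u v => [//|[j r]] [//|[k s]] /= /eqP ij /eqP ik.
by subst j k; rewrite !eqxx /mdist/= eqxx.
Qed.

Lemma position_on i u : on_branch i u -> 0 <= position i u.
Proof. by rewrite /position => ->; exact: height_ge0. Qed.

Lemma position_off i u : ~~ on_branch i u -> position i u <= 0.
Proof. by rewrite /position => /negbTE ->; rewrite oppr_le0; exact: mdist_ge0. Qed.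

Lemma mdist_on_off i u v : on_branch i u -> ~~ on_branch i v ->
  mdist u v = position i u - position i v.
Proof.
move=> iu iv; rewrite mdist_off.
  rewrite /position iu (negbTE iv) opprK mdist_off//= add0r addrA.
  by case: u iu => [//|[j r] /= /eqP ij]; subst j.
by case: u iu => [//|[j r]] /= /eqP ij k /eqP jk; subst j k.
Qed.

Lemma mdist_off_off i u v : ~~ on_branch i u -> ~~ on_branch i v ->
  mdist u v <= - position i u - position i v.
Proof.
move=> /negbTE iu /negbTE iv; rewrite /position iu iv !opprK.
by rewrite (metric_sym _ u); exact: metric_triangle.
Qed.

Lemma mdist_on i u v : on_branch i u || on_branch i v ->
  mdist u v = `|position i u - position i v|.
Proof.
have [iu|iu] := boolP (on_branch i u); have [iv|iv] := boolP (on_branch i v) => //= _.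
- exact: mdist_on_on.
- have := position_on iu; have := position_off iv => ? ?.
  by rewrite (mdist_on_off iu iv) ger0_norm; lra.
- have := position_on iv; have := position_off iu => ? ?.
  by rewrite metric_sym (mdist_on_off iv iu) distrC ger0_norm; lra.
Qed.

Lemma mdist_on_on_le i u v : on_branch i u -> on_branch i v ->
  mdist u v <= position i u + position i v.
Proof.
move=> iu iv; rewrite (mdist_on_on iu iv) ler_norml.
by have := position_on iu; have := position_on iv => *; apply/andP; split; lra.
Qed.

(** All geodesics from [u] or [v] to [w] or [t] pass through [x i]: the two mixed sums agree and
    dominate the third. *)
Lemma four_point_two i (u v w t : G) : on_branch i u -> on_branch i v ->
  ~~ on_branch i w -> ~~ on_branch i t ->
  mdist u v + mdist w t <= mdist u w + mdist v t /\
  mdist u v + mdist w t <= mdist u t + mdist v w /\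
  mdist u w + mdist v t = mdist u t + mdist v w.
Proof.
move=> iu iv iw it.
have := mdist_on_on_le iu iv; have := mdist_off_off iw it.
rewrite (mdist_on_off iu iw) (mdist_on_off iu it) (mdist_on_off iv iw) (mdist_on_off iv it).
by lra.
Qed.

Lemma glued_four_point : four_point T -> four_point G.
Proof.
move=> fp a b c e.
have [[i]|no] := pselect (exists i,
  [|| on_branch i a && on_branch i b, on_branch i a && on_branch i c,
      on_branch i a && on_branch i e, on_branch i b && on_branch i c,
      on_branch i b && on_branch i e | on_branch i c && on_branch i e]).
  have [ia|ia] := boolP (on_branch i a); have [ib|ib] := boolP (on_branch i b);
  have [ic|ic] := boolP (on_branch i c); have [ie|ie] := boolP (on_branch i e) => //= _;
  (* With at least three points on the branch, every pair meets it, and [position i] reduces the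
     claim to the line. The bullets treat exactly two. *)
  try by rewrite !(@mdist_on i) ?ia ?ib ?ic ?ie ?orbT//; exact: four_point_line.
  - by left; have := four_point_two ia ib ic ie; lra.
  - by right; have := four_point_two ia ic ib ie; rewrite (metric_sym c b); lra.
  - by left; have := four_point_two ia ie ib ic; rewrite (metric_sym e b) (metric_sym e c); lra.
  - by left; have := four_point_two ib ic ia ie; rewrite (metric_sym b a) (metric_sym c a); lra.
  - right; have := four_point_two ib ie ia ic.
    by rewrite (metric_sym b a) (metric_sym e a) (metric_sym e c); lra.
  - left; have := four_point_two ic ie ia ib.
    by rewrite (metric_sym c a) (metric_sym e b) (metric_sym e a) (metric_sym c b); lra.
have off u v : (forall i, ~ (on_branch i u && on_branch i v)) ->
    mdist u v = height u + mdist (base u) (base v) + height v.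
  move=> H; rewrite mdist_off// => i iu; apply/negP => iv.
  by apply: (H i); rewrite iu.
(* No branch carries two of the points: each of the three sums is the sum of the four heights plus
   the corresponding sum for the bases. *)
do 6![rewrite off; last by move=> i H; apply: no; exists i; rewrite H ?orbT].
by have [] := fp (base a) (base b) (base c) (base e) => ?; [left|right]; lra.
Qed.

Lemma has_between_sym (T' : metricType R) (u v : T') (s : R) :
  (exists2 z, mdist v z = mdist v u - s & mdist z u = s) ->
  exists2 z, mdist u z = s & mdist z v = mdist u v - s.
Proof. by move=> [z vz zu]; exists z; rewrite metric_sym// (metric_sym u) vz. Qed.

Lemma glued_has_between : has_between T -> has_between G.
Proof.
move=> hb.
have old_new a i (r s : R) : 0 <= r <= l i -> 0 <= s <= mdist (old a) (new i r) ->
    exists2 z, mdist (old a) z = s & mdist z (new i r) = mdist (old a) (new i r) - s.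
  move=> rl; rewrite mdist_old_new// => /andP[s0 sl]; move/andP: (rl) => [r0 rli].
  have [sx|xs] := leP s (mdist a (x i)).
    have [|z az zx] := hb a (x i) s; first by rewrite s0.
    by exists (old z); rewrite ?mdist_old// mdist_old_new// zx; lra.
  have tl : 0 <= s - mdist a (x i) <= l i by apply/andP; split; lra.
  exists (new i (s - mdist a (x i))); rewrite ?mdist_old_new//; first by lra.
  by rewrite mdist_new_same// distrC ger0_norm; lra.
move=> u v s; have [[a ->]|[i [r [/andP[/ltW r0 rl] ->]]]] := glued_cases u.
  have [[b ->]|[j [r [/andP[/ltW r0 rl] ->]]]] := glued_cases v.
    by rewrite mdist_old => /hb[z az zb]; exists (old z).
  by apply: old_new; rewrite r0.
have rI : 0 <= r <= l i by rewrite r0.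
have [[b ->]|[j [t [/andP[/ltW t0 tl] ->]]]] := glued_cases v.
  move=> /andP[s0 sl]; apply: has_between_sym.
  have [//||z bz zr] := old_new b i r (mdist (old b) (new i r) - s) => //.
    by rewrite (metric_sym (old b)); apply/andP; split; lra.
  by exists z; rewrite ?bz// zr; lra.
have tI : 0 <= t <= l j by rewrite t0.
have [ij|ij] := eqVneq i j.
  subst j.
  have le (p q s' : R) : 0 <= p <= l i -> 0 <= q <= l i -> p <= q ->
      0 <= s' <= mdist (new i p) (new i q) ->
      exists2 z, mdist (new i p) z = s' & mdist z (new i q) = mdist (new i p) (new i q) - s'.
    move=> pI qI pq; rewrite mdist_new_same// distrC ger0_norm ?subr_ge0// => /andP[s0 sl].
    have zI : 0 <= p + s' <= l i.
      by move/andP: pI => [? ?]; move/andP: qI => [? ?]; apply/andP; split; lra.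
    exists (new i (p + s')); rewrite !mdist_new_same//.
      by rewrite distrC ger0_norm; lra.
    by rewrite distrC ger0_norm; lra.
  move=> sI; have [rt|/ltW tr] := leP r t.
    exact: le.
  apply: has_between_sym.
  have [|z tz zr] := le t r (mdist (new i t) (new i r) - s) tI rI tr.
    by move: sI; rewrite metric_sym => /andP[? ?]; apply/andP; split; lra.
  by exists z; rewrite ?tz// zr; lra.
rewrite mdist_new_diff// => /andP[s0 sl].
have [sr|rs] := leP s r.
  have zI : 0 <= r - s <= l i by apply/andP; split; lra.
  exists (new i (r - s)); rewrite ?mdist_new_same// ?mdist_new_diff//; last by lra.
  by rewrite ger0_norm; lra.
(* The point lies beyond the branching point [x i], and is sought between [x i] and the other
   end. *)
have [//||z xz zt] := old_new (x i) j t (s - r) => //.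
  by rewrite mdist_old_new//; apply/andP; split; lra.
have : mdist (new i r) z = s /\ mdist z (new j t) = r + mdist (x i) (x j) + t - s; last first.
  by move=> [? ?]; exists z.
split; last by rewrite zt mdist_old_new//; lra.
(* The distance is at most [s] via [x i], and at least [s] because the remaining part cannot be
   shortened. *)
have := metric_triangle (new i r) (old (x i)) z.
have := metric_triangle (new i r) z (new j t).
by rewrite mdist_new_diff// mdist_new_old// mdistxx xz zt mdist_old_new//; lra.
Qed.

Lemma glued_tree_like : tree_like T -> tree_like G.
Proof. by move=> [? ?]; split; [exact: glued_four_point|exact: glued_has_between]. Qed.

Lemma height_le u e : 0 < e ->
  (forall i, on_branch i u -> l i < e) -> height u < e.
Proof.
by case: u => [//|[i [r /= /andP[_ rl]]]] _ /(_ i (eqxx i)); exact: le_lt_trans.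
Qed.

Lemma mdist_base u : mdist (old (base u)) u = height u.
Proof. by rewrite mdist_off//= mdistxx addr0 add0r. Qed.

(** An ultrafilter containing one branch converges in that compact segment. Any other one misses the
    first [N] branches for every [N], so the heights tend to 0 and the limit is that of the bases in
    [T]. *)
Lemma glued_compact : compact [set: T] ->
  (forall e, 0 < e -> exists N, forall i, (N <= i)%N -> l i < e) ->
  compact [set: G].
Proof.
move=> cT l0; rewrite compact_ultra => F UF _.
have [[i Fi]|no] := pselect (exists i, F [set u | on_branch i u]).
  have li0 : 0 <= l i.
    have [[//|[j [r /= h]]] /= /eqP <-] := filter_ex Fi.
    by move/andP: h => [? ?]; lra.
  pose f (s : segment (l i)) : G := new i (val s).
  have fi : isometric_embedding f.
    by move=> s t; rewrite mdist_new_same ?mdist_segment//; [exact: (valP s)|exact: (valP t)].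
  have [c _ Fc] : exists2 c, range f c & forall e : R, 0 < e -> F [set u | mdist c u < e].
    apply: ultra_near_compact.
      apply: continuous_compact; last exact: segment_compact_space.
      by apply: continuous_subspaceT; exact: isometric_continuous.
    apply: filterS Fi => -[//|[j [r h]]] /= /eqP ji; subst j.
    have r0 : 0 <= r <= l i by case/andP: h => /ltW -> ->.
    by exists (exist _ r r0); rewrite // /f/= (new_pointE h).
  by exists c; split => //; apply/metricType_numDomainType.fcvgrPdist_lt.
have [c _ Fc] : exists2 c, range old c &
    forall e : R, 0 < e -> F [set u | mdist c (old (base u)) < e].
  apply: ultra_near_compact.
    apply: continuous_compact cT; apply: continuous_subspaceT.
    exact: isometric_continuous.
  by apply: filterE => u; exists (base u).
exists c; split => //; apply/metricType_numDomainType.fcvgrPdist_lt => e e0.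
have e20 : 0 < e / 2 by rewrite divr_gt0.
have [N lN] := l0 _ e20.
have FN : F [set u | forall i, (i < N)%N -> ~~ on_branch i u].
  elim: N {lN} => [|N IH]; first by apply: filterE.
  have [|FN] := in_ultra_setVsetC [set u | on_branch N u] UF.
    by move=> ?; exfalso; apply: no; exists N.
  apply: filterS2 IH FN => u IH /= /negP uN i.
  by rewrite ltnS leq_eqVlt => /predU1P[->//|]; exact: IH.
apply: filterS2 FN (Fc _ e20) => u uN /= cu.
have : height u < e / 2.
  apply: height_le => // i iu; apply: lN; rewrite leqNgt; apply/negP => /uN.
  by rewrite iu.
have := metric_triangle c (old (base u)) u; rewrite mdist_base; lra.
Qed.

End glued_tree.

(** * Completion *)

Section completion.
Context {R : realType}.

Record pseudo_distance (I : Type) := PseudoDistance {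
  pdist :> I -> I -> R;
  pdistxx : forall i, pdist i i = 0;
  pdist_sym : forall i j, pdist i j = pdist j i;
  pdist_triangle : forall j i k, pdist i k <= pdist i j + pdist j k }.

(* A point of the completion is given by its distances to the elements of [I]. *)
Definition completion I (D : pseudo_distance I) := {f : I -> R |
  `[< forall e : R, 0 < e -> exists i, forall j, `|f j - D i j| <= e >]}.

Section metric.
Variables (I : Type) (D : pseudo_distance I).
Implicit Types f g h : completion D.

HB.instance Definition _ := gen_eqMixin (completion D).
HB.instance Definition _ := gen_choiceMixin (completion D).

Lemma completionP f (e : R) : 0 < e -> exists i, forall j, `|val f j - D i j| <= e.
Proof. exact: (asboolW (valP f)). Qed.

Lemma pdist_dist i j k : `|D i k - D j k| <= D i j.
Proof.
have := pdist_triangle D j i k; have := pdist_triangle D i j k.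
by rewrite (pdist_sym D j i) ler_norml => ? ?; apply/andP; split; lra.
Qed.

Definition sup_dist f g : R := sup [set `|val f j - val g j| | j in [set: I]].

Lemma sup_dist_le f g (e : R) : (forall j, `|val f j - val g j| <= e) <-> sup_dist f g <= e.
Proof.
have [i fi] := completionP f ltr01; have [k gk] := completionP g ltr01.
have fg0 : [set `|val f j - val g j| | j in [set: I]] !=set0.
  by exists `|val f i - val g i|; exists i.
split=> [H|H j].
  by apply: ge_sup => // _ [j _ <-].
apply: le_trans H; apply: ub_le_sup; last by exists j.
(* [f] and [g] are within 1 of the rows of [i] and [k], which differ by at most [D i k]: the
   supremum is finite. *)
exists (2 + D i k) => _ [m _ <-].
have := fi m; have := gk m; have := pdist_dist i k m.
by rewrite !ler_norml => /andP[? ?] /andP[? ?] /andP[? ?]; apply/andP; split; lra.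
Qed.

Lemma sup_dist_ge f g j : `|val f j - val g j| <= sup_dist f g.
Proof. by move: j; apply/sup_dist_le. Qed.

Lemma sup_dist_ge0 f g : 0 <= sup_dist f g.
Proof.
by have [i _] := completionP f ltr01; apply: le_trans (sup_dist_ge f g i).
Qed.

Lemma sup_distxx f : sup_dist f f = 0.
Proof.
apply/eqP; rewrite eq_le sup_dist_ge0 andbT; apply/sup_dist_le => j.
by rewrite subrr normr0.
Qed.

Lemma sup_dist_positivity f g : sup_dist f g = 0 -> f = g.
Proof.
move=> fg; apply: val_inj; apply: funext => j; apply/eqP.
by have := sup_dist_ge f g j; rewrite fg normr_le0 subr_eq0.
Qed.

Lemma sup_dist_sym f g : sup_dist f g = sup_dist g f.
Proof.
apply/eqP; rewrite eq_le; apply/andP.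
by split; apply/sup_dist_le => j; rewrite distrC sup_dist_ge.
Qed.

Lemma sup_dist_triangle g f h : sup_dist f h <= sup_dist f g + sup_dist g h.
Proof.
apply/sup_dist_le => j; apply: le_trans (ler_distD (val g j) _ _) _.
by rewrite lerD// sup_dist_ge.
Qed.

HB.instance Definition _ := isMetric.Build R (completion D)
  sup_distxx sup_dist_positivity sup_dist_sym sup_dist_triangle.

Lemma mdist_completion f g : mdist f g = sup_dist f g.
Proof. by []. Qed.

Lemma to_completion_subproof i :
  `[< forall e : R, 0 < e -> exists k, forall j, `|D i j - D k j| <= e >].
Proof. by apply/asboolP => e e0; exists i => j; rewrite subrr normr0 ltW. Qed.

Definition to_completion i : completion D := exist _ (D i) (to_completion_subproof i).

Lemma mdist_to_completion i j : mdist (to_completion i) (to_completion j) = D i j.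
Proof.
apply/eqP; rewrite eq_le; apply/andP; split.
  by rewrite mdist_completion; apply/sup_dist_le => k; exact: pdist_dist.
apply: le_trans (sup_dist_ge _ _ j) => /=.
by rewrite pdistxx subr0 ler_norm.
Qed.

Lemma to_completion_dense f (e : R) : 0 < e -> exists i, mdist (to_completion i) f < e.
Proof.
move=> e0; have e20 : 0 < e / 2 by rewrite divr_gt0.
have [i fi] := completionP f e20.
exists i; rewrite mdist_completion (@le_lt_trans _ _ (e / 2)) //; last by lra.
by apply/sup_dist_le => j; rewrite distrC.
Qed.

Lemma completion_complete (F : set_system (completion D)) : ProperFilter F ->
  (forall e : R, 0 < e -> exists c, F [set f | mdist c f < e]) ->
  exists f : completion D, F --> f.
Proof.
move=> FF cF.
pose e n : R := n.+1%:R^-1.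
have e0 n : 0 < e n by rewrite /e invr_gt0.
have /choice[i iF] : forall n, exists i, F [set f | mdist (to_completion i) f < e n].
  move=> n.
  have e20 : 0 < e n / 2 by rewrite divr_gt0.
  have [c Fc] := cF _ e20; have [i ic] := to_completion_dense c e20.
  exists i; apply: filterS Fc => f /= cf.
  by have := metric_triangle (to_completion i) c f; lra.
have ii k n : D (i k) (i n) <= e k + e n.
  have [f [/= kf nf]] := filter_ex (filterI (iF k) (iF n)).
  have := metric_triangle (to_completion (i k)) f (to_completion (i n)).
  by rewrite mdist_to_completion (metric_sym f); lra.
(* The limit of [D (i k) j], written as a supremum of lower bounds: every [D (i n) j + e n] is an
   upper bound by [ub], which gives the rate [e n] directly. *)
pose phi j := sup [set D (i k) j - e k | k in [set: nat]].
have phi0 j : [set D (i k) j - e k | k in [set: nat]] !=set0.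
  by exists (D (i 0%N) j - e 0%N); exists 0%N.
have ub n j k : D (i k) j - e k <= D (i n) j + e n.
  by have := pdist_triangle D (i n) (i k) j; have := ii k n; lra.
have phiP n j : `|phi j - D (i n) j| <= e n.
  rewrite ler_norml; apply/andP; split.
    suff : D (i n) j - e n <= phi j by lra.
    apply: ub_le_sup; last by exists n.
    by exists (D (i n) j + e n) => _ [k _ <-].
  suff : phi j <= D (i n) j + e n by lra.
  by apply: ge_sup => // _ [k _ <-].
have small (r : R) : 0 < r -> exists n, e n < r.
  by move=> /ltr_add_invr[n]; rewrite add0r; exists n.
have phic : `[< forall r : R, 0 < r -> exists i, forall j, `|phi j - D i j| <= r >].
  apply/asboolP => r /small[n nr]; exists (i n) => j.
  exact: le_trans (phiP n j) (ltW nr).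
exists (exist _ phi phic).
apply/metricType_numDomainType.fcvgrPdist_lt => r r0.
have [n nr] := small _ (divr_gt0 r0 (ltr0n R 2)).
apply: filterS (iF n) => f /= nf.
have : mdist (exist _ phi phic : completion D) (to_completion (i n)) <= e n.
  by rewrite mdist_completion; apply/sup_dist_le => j; exact: phiP.
have := metric_triangle (exist _ phi phic : completion D) (to_completion (i n)) f.
by lra.
Qed.

End metric.

Lemma four_point_dense (T : metricType R) (A : set T) :
  (forall x (e : R), 0 < e -> exists2 a, A a & mdist a x < e) ->
  (forall a b c e : T, A a -> A b -> A c -> A e ->
     mdist a b + mdist c e <= mdist a c + mdist b e \/
     mdist a b + mdist c e <= mdist a e + mdist b c) ->
  four_point T.
Proof.
move=> dA fp a b c e; apply: contrapT => /not_orP[/negP h1 /negP h2].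
rewrite -ltNge in h1; rewrite -ltNge in h2.
set l := mdist a b + mdist c e in h1 h2 *.
(* Moving each point by less than [q] changes a distance by less than [2 * q] and a sum of two by
   less than [4 * q]; comparing two sums costs less than [8 * q], below the gap [9 * q]. *)
pose q := Num.min (l - (mdist a c + mdist b e)) (l - (mdist a e + mdist b c)) / 9.
have q0 : 0 < q by rewrite divr_gt0// lt_min !subr_gt0 h1.
have q1 : 9 * q <= l - (mdist a c + mdist b e).
  by rewrite mulrC divfK// ge_min lexx.
have q2 : 9 * q <= l - (mdist a e + mdist b c).
  by rewrite mulrC divfK// ge_min lexx orbT.
have [a' Aa aa] := dA a q q0; have [b' Ab bb] := dA b q q0.
have [c' Ac cc] := dA c q q0; have [e' Ae ee] := dA e q q0.
have close (u v u' v' : T) : mdist u' u < q -> mdist v' v < q ->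
    mdist u v - 2 * q < mdist u' v' < mdist u v + 2 * q.
  move=> uu vv; have := metric_triangle u u' v; have := metric_triangle u' v' v.
  have := metric_triangle u' u v'; have := metric_triangle u v v'.
  by rewrite (metric_sym u u') (metric_sym v v') => *; apply/andP; split; lra.
move/andP: (close _ _ _ _ aa bb) => [? ?]; move/andP: (close _ _ _ _ cc ee) => [? ?].
move/andP: (close _ _ _ _ aa cc) => [? ?]; move/andP: (close _ _ _ _ bb ee) => [? ?].
move/andP: (close _ _ _ _ aa ee) => [? ?]; move/andP: (close _ _ _ _ bb cc) => [? ?].
by rewrite /l in q1 q2; have [] := fp _ _ _ _ Aa Ab Ac Ae; lra.
Qed.

(** The defect [F] attains its minimum by compactness, and points between nearby elements of [A]
    make it arbitrarily small. *)
Lemma has_between_dense (T : metricType R) (A : set T) : compact [set: T] ->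
  (forall x (e : R), 0 < e -> exists2 a, A a & mdist a x < e) ->
  (forall (a b : T) (s : R), A a -> A b -> 0 <= s <= mdist a b ->
     exists2 z, mdist a z = s & mdist z b = mdist a b - s) ->
  has_between T.
Proof.
move=> cT dA hb x y s /andP[s0 sl].
pose F (z : T) : R := `|mdist x z - s| + `|mdist z y - (mdist x y - s)|.
have Fc : continuous F.
  move=> z; apply/cvgrPdist_lt => e e0; near=> u.
  have : mdist z u < e / 2 by near: u; apply: near_mdist; rewrite divr_gt0.
  have := ler_dist_dist (mdist x z - s) (mdist x u - s).
  have := ler_dist_dist (mdist z y - (mdist x y - s)) (mdist u y - (mdist x y - s)).
  have E (p q r : R) : (p - r) - (q - r) = p - q by lra.
  rewrite !E => h1 h2 zu.
  have h3 : `|mdist x z - mdist x u| <= mdist z u.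
    have := metric_triangle x z u; have := metric_triangle x u z.
    by rewrite (metric_sym u z) ler_norml => *; apply/andP; split; lra.
  have h4 : `|mdist z y - mdist u y| <= mdist z u.
    have := metric_triangle z u y; have := metric_triangle u z y.
    by rewrite (metric_sym u z) ler_norml => *; apply/andP; split; lra.
  move: (le_trans h1 h4) (le_trans h2 h3); rewrite /F !ler_norml ltr_norml.
  by move=> /andP[? ?] /andP[? ?]; apply/andP; split; lra.
have [||z _ Fz] := @compact_EVT_min _ _ F _ _ cT; first by exists x.
  exact: continuous_subspaceT.
have F0 : F z <= 0.
  apply/ler_addgt0Pl => e e0; rewrite addr0.
  pose q := e / 10; have q0 : 0 < q by rewrite divr_gt0.
  have eq : e = 10 * q by rewrite /q mulrC divfK.
  have [a Aa ax] := dA x _ q0; have [b Ab b_y] := dA y _ q0.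
  have := metric_triangle x a y; have := metric_triangle a b y.
  have := metric_triangle a x b; have := metric_triangle x y b.
  rewrite (metric_sym x a) (metric_sym y b) => h1 h2 h3 h4.
  (* [s] may exceed [mdist a b], but by at most [2 * q]. The two terms of [F w] are then at most
     [3 * q] and [5 * q], and [3 * q + 5 * q] is below [e]. *)
  have sa : 0 <= Num.min s (mdist a b) <= mdist a b.
    by rewrite le_min s0 mdist_ge0 ge_min lexx orbT.
  have [w aw wb] := hb a b _ Aa Ab sa.
  apply: le_trans (Fz w _) _; first by rewrite inE.
  have ms : s - 2 * q <= Num.min s (mdist a b) <= s.
    by rewrite le_min ge_min lexx /= andbT; apply/andP; split; lra.
  move/andP: ms => [m1 m2].
  have := metric_triangle x a w; have := metric_triangle a x w.
  have := metric_triangle w b y; have := metric_triangle w y b.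
  rewrite (metric_sym x a) (metric_sym y b) aw wb => h5 h6 h7 h8.
  have F1 : `|mdist x w - s| <= 3 * q by rewrite ler_norml; apply/andP; split; lra.
  have F2 : `|mdist w y - (mdist x y - s)| <= 5 * q by rewrite ler_norml; apply/andP; split; lra.
  by rewrite /F; lra.
have [] : `|mdist x z - s| = 0 /\ `|mdist z y - (mdist x y - s)| = 0.
  have := normr_ge0 (mdist x z - s); have := normr_ge0 (mdist z y - (mdist x y - s)).
  by move: F0; rewrite /F; lra.
by move=> /normr0_eq0/subr0_eq xz /normr0_eq0/subr0_eq zy; exists z.
Unshelve. all: by end_near. Qed.

End completion.

(** * Gromov-Hausdorff distance *)

Section gromov_hausdorff.
Context {R : realType}.
Local Open Scope ereal_scope.

Lemma hausdorff_dist_le (M : metricType R) (A B : set M) (e : R) : (0 < e)%R ->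
  (forall a, A a -> exists2 b, B b & (mdist a b < e)%R) ->
  (forall b, B b -> exists2 a, A a & (mdist a b < e)%R) ->
  hausdorff_dist A B <= e%:E.
Proof. by move=> e0 AB BA; apply: ereal_inf_lbound; exists e. Qed.

Lemma gh_dist_le (S T : rooted_space R) (M : metricType R) (f : S -> M) (g : T -> M) (e : R) :
  (0 < e)%R -> isometric_embedding f -> isometric_embedding g ->
  (mdist (f (Defs.root S)) (g (Defs.root T)) <= e)%R ->
  (forall s, exists t, mdist (f s) (g t) < e)%R ->
  (forall t, exists s, mdist (f s) (g t) < e)%R ->
  gh_dist S T <= e%:E.
Proof.
move=> e0 fi gi fg st ts; apply: le_trans (ereal_inf_lbound _) _.
  by exists M, f, g; split.
rewrite ge_max lee_fin fg/=; apply: hausdorff_dist_le => //.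
  by move=> _ [s _ <-]; have [t ?] := st s; exists (g t) => //; exists t.
by move=> _ [t _ <-]; have [s ?] := ts t; exists (f s) => //; exists s.
Qed.

Lemma gh_dist_ge0 (S T : rooted_space R) : 0 <= gh_dist S T.
Proof.
apply: le_ereal_inf_tmp => _ [M [f [g [_ _ ->]]]].
by rewrite le_max lee_fin mdist_ge0.
Qed.

Local Close Scope ereal_scope.

(** Exactly what extends the two metrics to the disjoint union; strict positivity makes the result a
    metric and not only a pseudometric. *)
Record coupling (S T : metricType R) := Coupling {
  cross : S -> T -> R;
  cross_gt0 : forall s t, 0 < cross s t;
  crossl : forall s s' t, cross s t <= mdist s s' + cross s' t;
  crossr : forall s t t', cross s t <= cross s t' + mdist t' t;
  cross_mdistl : forall s s' t, mdist s s' <= cross s t + cross s' t;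
  cross_mdistr : forall s t t', mdist t t' <= cross s t + cross s t' }.

Section coupled.
Variables (S T : metricType R) (c : coupling S T).

(** The phantom argument lets the metric instance depend on the coupling. *)
Definition coupled (_ : coupling S T) : Type := (S + T)%type.

HB.instance Definition _ := Choice.on (coupled c).

Definition coupled_dist (u v : coupled c) : R :=
  match u, v with
  | inl s, inl s' => mdist s s'
  | inl s, inr t => cross c s t
  | inr t, inl s => cross c s t
  | inr t, inr t' => mdist t t'
  end.

Lemma coupled_distxx u : coupled_dist u u = 0.
Proof. by case: u => ?; exact: mdistxx. Qed.

Lemma coupled_dist_positivity u v : coupled_dist u v = 0 -> u = v.
Proof.
case: u v => [s|t] [s'|t'] /=.
- by move/mdist_positivity ->.
- by have := cross_gt0 c s t' => + e; rewrite e ltxx.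
- by have := cross_gt0 c s' t => + e; rewrite e ltxx.
- by move/mdist_positivity ->.
Qed.

Lemma coupled_dist_sym u v : coupled_dist u v = coupled_dist v u.
Proof. by case: u v => [s|t] [s'|t'] //=; exact: metric_sym. Qed.

Lemma coupled_dist_triangle v u w :
  coupled_dist u w <= coupled_dist u v + coupled_dist v w.
Proof.
case: u v w => [a|a] [b|b] [e|e] /=.
- exact: metric_triangle.
- exact: crossl.
- exact: cross_mdistl.
- exact: crossr.
- by rewrite metric_sym addrC; exact: crossl _ _ _ _ => //; rewrite metric_sym.
- exact: cross_mdistr.
- by rewrite addrC (metric_sym a); exact: crossr.
- exact: metric_triangle.
Qed.

HB.instance Definition _ := isMetric.Build R (coupled c)
  coupled_distxx coupled_dist_positivity coupled_dist_sym coupled_dist_triangle.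

End coupled.

Section correspondence.
Variables (S T : metricType R) (C : S -> T -> Prop) (e : R).
Hypothesis e0 : 0 < e.
Hypothesis C0 : exists s t, C s t.
Hypothesis distortion : forall s s' t t', C s t -> C s' t' ->
  `|mdist s s' - mdist t t'| <= 2 * e.

(** The cheapest passage from [s] to [t] through a related pair, each crossing costing [e]. A return
    trip crosses twice, which pays for the distortion [2 * e] in the triangle inequalities. *)
Definition correspondence_cross (s : S) (t : T) : R :=
  inf [set r | exists a b, C a b /\ r = mdist s a + e + mdist b t].

Lemma cross_le s t a b : C a b -> correspondence_cross s t <= mdist s a + e + mdist b t.
Proof.
move=> Cab; apply: ge_inf; last by exists a, b.
by exists 0 => _ [a' [b' [_ ->]]]; rewrite !addr_ge0 ?mdist_ge0 ?(ltW e0).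
Qed.

Lemma le_cross s t (r : R) :
  (forall a b, C a b -> r <= mdist s a + e + mdist b t) -> r <= correspondence_cross s t.
Proof.
move=> H; apply: lb_le_inf; last by move=> _ [a [b [Cab ->]]]; exact: H.
by have [a [b Cab]] := C0; exists (mdist s a + e + mdist b t); exists a, b.
Qed.

Lemma correspondence_cross_gt0 s t : 0 < correspondence_cross s t.
Proof.
apply: lt_le_trans e0 _; apply: le_cross => a b _.
by have := mdist_ge0 s a; have := mdist_ge0 b t; lra.
Qed.

Lemma correspondence_crossl s s' t :
  correspondence_cross s t <= mdist s s' + correspondence_cross s' t.
Proof.
rewrite -lerBlDl; apply: le_cross => a b Cab.
by have := cross_le s t Cab; have := metric_triangle s s' a; lra.
Qed.

Lemma correspondence_crossr s t t' :
  correspondence_cross s t <= correspondence_cross s t' + mdist t' t.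
Proof.
rewrite -lerBlDr; apply: le_cross => a b Cab.
by have := cross_le s t Cab; have := metric_triangle b t' t; lra.
Qed.

Lemma correspondence_mdistl s s' t :
  mdist s s' <= correspondence_cross s t + correspondence_cross s' t.
Proof.
rewrite -lerBlDr; apply: le_cross => a b Cab.
rewrite lerBlDr addrC -lerBlDr; apply: le_cross => a' b' Cab'.
have := distortion Cab Cab'; rewrite ler_norml => /andP[_].
have := metric_triangle s a s'; have := metric_triangle a a' s'.
have := metric_triangle b t b'; rewrite (metric_sym b' t) (metric_sym a' s').
by lra.
Qed.

Lemma correspondence_mdistr s t t' :
  mdist t t' <= correspondence_cross s t + correspondence_cross s t'.
Proof.
rewrite -lerBlDr; apply: le_cross => a b Cab.
rewrite lerBlDr addrC -lerBlDr; apply: le_cross => a' b' Cab'.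
have := distortion Cab Cab'; rewrite ler_norml => /andP[+ _].
have := metric_triangle t b t'; have := metric_triangle b b' t'.
have := metric_triangle a s a'; rewrite (metric_sym t b) (metric_sym a s).
by lra.
Qed.

Definition correspondence_coupling : coupling S T :=
  Coupling correspondence_cross_gt0 correspondence_crossl correspondence_crossr
    correspondence_mdistl correspondence_mdistr.

End correspondence.

(** Related points are at distance at most [e]; the factor 2 leaves room for the strict inequalities
    in [hausdorff_dist]. *)
Lemma gh_dist_correspondence (S T : rooted_space R) (C : S -> T -> Prop) (e : R) :
  0 < e -> C (Defs.root S) (Defs.root T) ->
  (forall s, exists t, C s t) -> (forall t, exists s, C s t) ->
  (forall s s' t t', C s t -> C s' t' -> `|mdist s s' - mdist t t'| <= 2 * e) ->
  (gh_dist S T <= (2 * e)%:E)%E.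
Proof.
move=> e0 Cr Cs Ct Cd.
have C0 : exists s t, C s t by exists (Defs.root S), (Defs.root T).
pose M := coupled (correspondence_coupling e0 C0 Cd).
have Ce s t : C s t -> correspondence_cross C e s t <= e.
  by move=> Cst; have := cross_le e0 s t Cst; rewrite !mdistxx addr0 add0r.
apply: (@gh_dist_le S T M inl inr) => //; first by rewrite mulr_gt0.
- by apply: le_trans (Ce _ _ Cr) _; lra.
- by move=> s; have [t /Ce st] := Cs s; exists t; apply: le_lt_trans st _; lra.
- by move=> t; have [s /Ce st] := Ct t; exists s; apply: le_lt_trans st _; lra.
Qed.

(** Two points are related when they are close to net points of the same index; index 0 relates the
    roots. The distortion is at most [2 * e] in each space plus [e] between the nets. *)
Lemma gh_dist_nets (S T : rooted_space R) (N : nat) (u : nat -> S) (v : nat -> T) (e : R) :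
  0 < e -> u 0%N = Defs.root S -> v 0%N = Defs.root T ->
  (forall s, exists2 i, (i <= N)%N & mdist (u i) s <= e) ->
  (forall t, exists2 i, (i <= N)%N & mdist (v i) t <= e) ->
  (forall i j, (i <= N)%N -> (j <= N)%N ->
    `|mdist (u i) (u j) - mdist (v i) (v j)| <= e) ->
  (gh_dist S T <= (5 * e)%:E)%E.
Proof.
move=> e0 u0 v0 uN vN uv.
rewrite (_ : 5 * e = 2 * (5 / 2 * e)); last by lra.
apply: (@gh_dist_correspondence S T (fun s t =>
  exists2 i, (i <= N)%N & mdist (u i) s <= e /\ mdist (v i) t <= e)).
- by rewrite mulr_gt0.
- by exists 0%N => //; rewrite u0 v0 !mdistxx; split; exact: ltW.
- by move=> s; have [i iN us] := uN s; exists (v i), i => //; split=> //; rewrite mdistxx ltW.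
- by move=> t; have [i iN us] := vN t; exists (u i), i => //; split=> //; rewrite mdistxx ltW.
move=> s s' t t' [i iN [us vt]] [j jN [us' vt']].
have := uv i j iN jN; rewrite !ler_norml => /andP[? ?].
have := metric_triangle (u i) s (u j); have := metric_triangle s s' (u j).
have := metric_triangle s (u i) s'; have := metric_triangle (u i) (u j) s'.
have := metric_triangle (v i) t (v j); have := metric_triangle t t' (v j).
have := metric_triangle t (v i) t'; have := metric_triangle (v i) (v j) t'.
rewrite (metric_sym s (u i)) (metric_sym s' (u j)) (metric_sym t (v i)) (metric_sym t' (v j)).
by move=> *; apply/andP; split; lra.
Qed.

End gromov_hausdorff.

Section measurability.
Context {R : realType} {d : measure_display} {Omega : measurableType d}.

(* The event [U (S w)] is the union of the cells that it contains: the tree varies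
   by at most [5 * e] on a cell, hence a cell around [w] with small [e] stays in [U]. *)
Lemma measurable_of_cells (S : Omega -> compact_real_tree R) (G : set Omega)
    (I : countType) (cell : R -> I -> set Omega) :
  (forall e q, 0 < e -> measurable (cell e q)) ->
  (forall e w, 0 < e -> G w -> exists q, cell e q w) ->
  (forall e q w w', 0 < e -> G w -> G w' -> cell e q w -> cell e q w' ->
    (gh_dist (S w) (S w') <= (5 * e)%:E)%E) ->
  measurable G ->
  forall U, gh_open U -> measurable (G `&` [set w | U (S w)]).
Proof.
move=> mc cov gh mG U Uo.
pose e n : R := n.+1%:R^-1.
have e0 n : 0 < e n by rewrite /e invr_gt0.
have -> : G `&` [set w | U (S w)] = G `&` \bigcup_n \bigcup_(q in
    [set q | cell (e n) q `&` G `<=` [set w | U (S w)]]) cell (e n) q.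
  apply/seteqP; split => [w [Gw /Uo[r r0 rU]]|w [Gw [n _ [q qU qw]]]]; last first.
    by split=> //; apply: qU.
  split => //; have /ltr_add_invr[n] : 0 < r / 5 by rewrite divr_gt0.
  rewrite add0r => nr; have [q qw] := cov _ _ (e0 n) Gw.
  exists n => //; exists q => // w' [qw' Gw'] /=; apply: rU.
  apply: le_lt_trans (gh _ _ _ _ (e0 n) Gw Gw' qw qw') _.
  by rewrite lte_fin; move: nr; rewrite -/(e n); lra.
apply: measurableI => //; apply: bigcupT_measurable => n.
rewrite bigcup_mkcond; apply: countable_bigcupT_measurable; first exact: countableP.
by move=> q; case: ifP => // _; exact: mc.
Qed.

End measurability.

(** * Coding of the stages and their limit *)

Section codes.
Context {R : realType}.
Variables (beta : R) (xi : bead_string R) (copy : nat -> nat -> bead_string R)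
  (enum : nat -> nat -> nat * nat).
Notation T := (stage beta xi copy enum).

Definition branch_len n i : R := atom_mass (T n) i `^ beta * len (copy n i).

Lemma branch_len_ge0 n i : 0 <= branch_len n i.
Proof. by rewrite mulr_ge0 ?powR_ge0// ltW// len_gt0. Qed.

(* [(0, i, r)] codes the point at distance [r L] from the root of the initial
   interval and [(n.+1, i, r)] the point at relative height [r] on the [i]-th branch
   grafted on stage [n] (with [r] truncated to [0, 1]). *)
Definition code : Type := (nat * nat * R)%type.
Implicit Types c : code.

Definition level c := c.1.1.
Definition ratio c : R := clip 0 1 c.2.

Lemma ratio_itv c : 0 <= ratio c <= 1.
Proof. by have := clip_itv c.2 (@ler01 R). Qed.

Lemma ratio_mul c (l : R) : 0 <= l -> 0 <= ratio c * l <= l.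
Proof.
move=> l0; have /andP[r0 r1] := ratio_itv c.
by rewrite mulr_ge0//= ler_piMl.
Qed.

(** Meaningful for [level c <= n] only; a code of higher level gets an arbitrary value. *)
Fixpoint point n c : T n :=
  match n with
  | 0%N => segment_point (ltW (len_gt0 xi)) (ratio c * len xi)
  | m.+1 => if (level c <= m)%N then old_point _ (branch_len m) (point m c)
            else new_point _ (branch_len m) c.1.2 (ratio c * branch_len m c.1.2)
  end.

Lemma point_old n c : (level c <= n)%N ->
  point n.+1 c = old_point (@atom_loc R (T n)) (branch_len n) (point n c).
Proof. by move=> /= ->. Qed.

Lemma point_new n c : level c = n.+1 ->
  point n.+1 c = new_point (@atom_loc R (T n)) (branch_len n) c.1.2
    (ratio c * branch_len n c.1.2).
Proof. by move=> /= ->; rewrite ltnn. Qed.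

Lemma mdist_point_le n m c c' : (level c <= n)%N -> (level c' <= n)%N -> (n <= m)%N ->
  mdist (point m c) (point m c') = mdist (point n c) (point n c').
Proof.
move=> cn cn'; elim: m => [|m IH]; first by rewrite leqn0 => /eqP ->.
rewrite leq_eqVlt => /predU1P[->//|nm]; rewrite -IH//.
by rewrite !point_old// (leq_trans _ (nm : n <= m)%N).
Qed.

(** Measured at the first stage that contains both points, as later grafting preserves distances. It
    is only a pseudo-distance, since a point has several codes, for instance every branching
    point. *)
Definition code_dist c c' : R :=
  mdist (point (maxn (level c) (level c')) c) (point (maxn (level c) (level c')) c').

Lemma mdist_point n c c' : (level c <= n)%N -> (level c' <= n)%N ->
  mdist (point n c) (point n c') = code_dist c c'.
Proof.
by move=> cn cn'; apply: mdist_point_le; rewrite ?leq_maxl ?leq_maxr// geq_max cn.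
Qed.

Lemma code_distxx c : code_dist c c = 0.
Proof. exact: mdistxx. Qed.

Lemma code_dist_sym c c' : code_dist c c' = code_dist c' c.
Proof. by rewrite /code_dist maxnC metric_sym. Qed.

Lemma code_dist_triangle c' c c'' : code_dist c c'' <= code_dist c c' + code_dist c' c''.
Proof.
pose n := maxn (level c) (maxn (level c') (level c'')).
have h1 : (level c <= n)%N by rewrite leq_maxl.
have h2 : (level c' <= n)%N by rewrite /n !leq_max leqnn orbT.
have h3 : (level c'' <= n)%N by rewrite /n !leq_max leqnn !orbT.
by rewrite -!(@mdist_point n)//; exact: metric_triangle.
Qed.

Definition code_distance : @pseudo_distance R code :=
  PseudoDistance code_distxx code_dist_sym code_dist_triangle.

Definition root_code : code := (0%N, 0%N, 0).

Lemma point_root n : point n root_code = Defs.root (T n).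
Proof.
elim: n => [|n IH]; last by rewrite point_old// IH.
apply: val_inj; rewrite val_segment_point /= /ratio clip_id ?in_itv/= ?lexx ?ler01// mul0r//.
by rewrite lexx ltW// len_gt0.
Qed.

Lemma point_surj n (x : T n) : exists2 c, (level c <= n)%N & point n c = x.
Proof.
elim: n x => [|n IH] x.
  have l0 := len_gt0 xi.
  have /andP[x0 xl] := valP x; exists (0%N, 0%N, val x / len xi) => //=.
  rewrite /ratio clip_id/= ?divfK ?gt_eqF//; first exact: segment_pointK.
  by rewrite in_itv/= divr_ge0 ?(ltW l0)//= ler_pdivrMr// mul1r.
have [[a ->]|[i [r [/andP[r0 rl] ->]]]] := glued_cases x.
  have [c cn <-] := IH a; exists c; first exact: (leqW cn).
  by rewrite point_old.
exists (n.+1, i, r / branch_len n i) => //.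
have l0 : 0 < branch_len n i by exact: lt_le_trans rl.
rewrite point_new//= /ratio clip_id/= ?divfK ?gt_eqF//.
by rewrite in_itv/= divr_ge0 ?(ltW l0) ?(ltW r0)//= ler_pdivrMr// mul1r.
Qed.

Lemma stage_tree_like n : tree_like (T n).
Proof.
elim: n => [|n IH]; last exact: glued_tree_like.
exact/segment_tree_like/ltW/len_gt0.
Qed.

Lemma stage_compact n :
  (forall m e, 0 < e -> exists N, forall i, (N <= i)%N -> branch_len m i < e) ->
  compact [set: T n].
Proof.
move=> l0; elim: n => [|n IH]; last exact: (glued_compact IH (l0 n)).
exact/segment_compact_space/ltW/len_gt0.
Qed.

Lemma code_parent n c : level c = n.+1 ->
  exists2 c', (level c' <= n)%N & code_dist c c' <= branch_len n c.1.2.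
Proof.
move=> cn; have [c' cn' c'x] := point_surj (@atom_loc R (T n) c.1.2).
exists c' => //; rewrite -(@mdist_point n.+1) ?cn//; last exact: leqW.
rewrite point_new// point_old// c'x; have /andP[r0 r1] := ratio_mul c (branch_len_ge0 n c.1.2).
by rewrite mdist_new_old ?r0// mdistxx add0r.
Qed.

(** Continuity in the ratio, which allows real ratios to be replaced by rational ones. *)
Lemma code_dist_ratio n i : exists2 l, 0 <= l &
  forall r s : R, code_dist (n, i, r) (n, i, s) <= l * `|r - s|.
Proof.
have cl (a b : R) : `|clip 0 1 a - clip 0 1 b| <= `|a - b|.
  have := ler_norm (a - b); have := ler_norm (b - a); rewrite (distrC b) => ? ?.
  rewrite ler_norml /clip /Num.max /Num.min.
  case: (ltP 1 a) => ?; case: (ltP 1 b) => ?; rewrite ?ltr01;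
  case: (ltP 0 a) => ?; case: (ltP 0 b) => ?; apply/andP; split; lra.
exists (if n is m.+1 then branch_len m i else len xi).
  by case: n => [|n]; [exact/ltW/len_gt0|exact: branch_len_ge0].
move=> r s; rewrite -(@mdist_point n)//.
case: n => [|n].
  have l0 := len_gt0 xi.
  rewrite mdist_segment !val_segment_point ?ratio_mul ?(ltW l0)//.
  by rewrite -mulrBl normrM (gtr0_norm l0) mulrC ler_pM2l// cl.
have l0 := branch_len_ge0 n i.
rewrite !point_new// mdist_new_same ?ratio_mul//.
by rewrite -mulrBl normrM (ger0_norm l0) mulrC ler_wpM2l// cl.
Qed.

(** A dense sequence that does not depend on the tree. It starts with the root, as [gh_dist_nets]
    requires at index 0. *)
Definition rational_code (k : nat) : code :=
  if k is k'.+1 then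
    if unpickle k' is Some q then (q.1.1, q.1.2, ratr (q.2 : rat)) else root_code
  else root_code.

Lemma rational_code_dense c (e : R) : 0 < e -> exists k, code_dist (rational_code k) c < e.
Proof.
case: c => [[n i] r] e0.
have [l l0 lP] := code_dist_ratio n i.
have l1 : 0 < l + 1 by lra.
have /rat_in_itvoo[q] : r - e / (l + 1) < r by rewrite ltrBlDr ltrDl divr_gt0.
rewrite in_itv/= => /andP[q1 q2].
exists (pickle (n, i, q)).+1; rewrite /= pickleK; apply: le_lt_trans (lP _ _) _.
have : `|ratr q - r| < e / (l + 1) by rewrite ltr0_norm; lra.
rewrite ltr_pdivlMr// => qe.
apply: le_lt_trans qe; rewrite mulrC ler_wpM2l//; lra.
Qed.

End codes.

Arguments code : clear implicits.

(** * The completion of the stages as a compact real tree *)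

Section limit.
Context {R : realType}.
Variables (beta : R) (xi : bead_string R) (copy : nat -> nat -> bead_string R)
  (enum : nat -> nat -> nat * nat).
Notation T := (stage beta xi copy enum).
Notation D := (code_distance beta xi copy enum).

Definition limit_space : rooted_space R :=
  @RootedSpace R (completion D) (to_completion D root_code).

Hypothesis branch_len_cvg0 :
  forall n e, 0 < e -> exists N, forall i, (N <= i)%N -> branch_len beta xi copy enum n i < e.

Lemma stage_compact_real_tree n : is_compact_real_tree (T n).
Proof. by apply: compact_tree_like; [exact: stage_tree_like|exact: stage_compact]. Qed.

Lemma stage_embedding n : exists f : T n -> limit_space,
  isometric_embedding f /\
  forall c, (level c <= n)%N -> f (point beta xi copy enum n c) = to_completion D c.
Proof.
have /choice[g gP] x : exists c, (level c <= n)%N /\ point beta xi copy enum n c = x.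
  by have [c ? ?] := point_surj x; exists c.
exists (fun x => to_completion D (g x)); split.
  move=> x y; rewrite mdist_to_completion.
  have [gx {2}<-] := gP x; have [gy {2}<-] := gP y.
  by rewrite mdist_point.
move=> c cn; apply: mdist_positivity; rewrite mdist_to_completion.
have [gx E] := gP (point beta xi copy enum n c).
by rewrite -[LHS](@mdist_point _ _ _ _ _ n)// E mdistxx.
Qed.

Variables (C rho : R).
Hypotheses (C0 : 0 < C) (rho0 : 0 < rho) (rho1 : rho < 1).
Hypothesis branch_len_le : forall n i, branch_len beta xi copy enum n i <= C * rho ^+ n.

Lemma code_approx n c : exists2 c', (level c' <= n)%N &
  D c c' <= C / (1 - rho) * rho ^+ n.
Proof.
pose K := C / (1 - rho).
have KC : K = C + K * rho by rewrite /K; field; rewrite subr_eq0 gt_eqF.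
have K0 : 0 < K by rewrite divr_gt0// subr_gt0.
have rn0 (m : nat) : 0 < rho ^+ m by rewrite exprn_gt0.
(* Descending through the branching points from level [m] to level [n] costs at most the sum of
   [C * rho ^+ k] for [n <= k < m], which is this difference. *)
suff H m : (n <= m)%N -> forall c, (level c <= m)%N -> exists2 c', (level c' <= n)%N &
    D c c' <= K * (rho ^+ n - rho ^+ m).
  have [|c' cn cc'] := H (maxn n (level c)) (leq_maxl _ _) c; first by rewrite leq_maxr.
  exists c' => //; apply: le_trans cc' _; rewrite ler_pM2l// lerBlDr lerDl ltW//.
elim: m => [|m IH] nm {}c cm.
  move: nm; rewrite leqn0 => /eqP ->; exists c => //.
  by rewrite pdistxx subrr mulr0.
move: nm; rewrite leq_eqVlt => /predU1P[->|nm].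
  by exists c => //; rewrite pdistxx subrr mulr0.
have KS : K * (rho ^+ n - rho ^+ m.+1) = K * (rho ^+ n - rho ^+ m) + C * rho ^+ m.
  by rewrite exprS; rewrite [in RHS](_ : C = K - K * rho); [ring|rewrite {1}KC; ring].
move: cm; rewrite leq_eqVlt => /predU1P[cm|cm]; last first.
  have [c' cn' cc'] := IH nm c cm; exists c' => //.
  apply: le_trans cc' _; rewrite KS lerDl mulr_ge0 ?ltW//.
have [c1 c1m cc1] := code_parent beta xi copy enum cm.
have [c' cn' cc'] := IH nm c1 c1m.
exists c' => //; rewrite KS.
have {}cc1 : D c c1 <= C * rho ^+ m := le_trans cc1 (branch_len_le m c.1.2).
by have := pdist_triangle D c1 c c'; lra.
Qed.

(** The additional 1 pays for approximating a point of the completion by a code, and makes the bound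
    strict. *)
Lemma stage_net n : exists (f : T n -> limit_space), [/\ isometric_embedding f,
  f (Defs.root (T n)) = Defs.root limit_space &
  forall x, exists s, mdist (f s) x < (C / (1 - rho) + 1) * rho ^+ n].
Proof.
have [f [fi fc]] := stage_embedding n; exists f; split => //.
  by rewrite -point_root fc.
move=> x; have rn0 : 0 < rho ^+ n by rewrite exprn_gt0.
have [c cx] := to_completion_dense x rn0.
have [c' cn' cc'] := code_approx n c.
exists (point beta xi copy enum n c'); rewrite fc//.
have := metric_triangle (to_completion D c') (to_completion D c) x.
by rewrite mdist_to_completion pdist_sym mulrDl mul1r; lra.
Qed.

Let K := C / (1 - rho) + 1.

Let K0 : 0 < K.
Proof. by rewrite addr_gt0// divr_gt0// subr_gt0. Qed.

Lemma gh_dist_stage n : (gh_dist (T n) limit_space <= (K * rho ^+ n)%:E)%E.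
Proof.
have [f [fi fr fx]] := stage_net n.
apply: (@gh_dist_le _ _ _ limit_space f id) => //.
- by rewrite mulr_gt0// exprn_gt0.
- by rewrite fr mdistxx mulr_ge0 ?exprn_ge0 ?ltW.
- by move=> s; exists (f s); rewrite mdistxx mulr_gt0// exprn_gt0.
Qed.

Lemma geometric_small (e : R) : 0 < e -> exists n, K * rho ^+ n < e.
Proof.
move=> e0; have : `|rho| < 1 by rewrite gtr0_norm.
move=> /cvg_expr/cvgrPdist_lt /(_ (e / K)); rewrite divr_gt0// => /(_ isT)[n _ /(_ n (leqnn n))].
by rewrite /= sub0r normrN ger0_norm ?exprn_ge0 ?ltW// ltr_pdivlMr// mulrC; exists n.
Qed.

(** The compact net at scale [e] is the image of stage [m e], and [h e] moves each point to a nearby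
    point of that image. *)
Lemma limit_compact : compact [set: limit_space].
Proof.
have /choice[m mP] e : exists n, 0 < e -> K * rho ^+ n < e.
  have [/geometric_small[n ne]|/negP e0] := boolP (0 < e); first by exists n.
  by exists 0%N.
have /choice[h hP] e : exists h : limit_space -> limit_space, exists2 B : set limit_space,
    compact B & forall x, B (h x) /\ mdist x (h x) < K * rho ^+ m e.
  have [f [fi _ fx]] := stage_net (m e); have [g gP] := choice fx.
  exists (f \o g); exists (range f); last first.
    by move=> x; split; [exists (g x)|rewrite metric_sym; exact: gP].
  apply: continuous_compact; last exact: stage_compact.
  by apply: continuous_subspaceT; exact: isometric_continuous.
have /choice[B BP] e : exists B : set limit_space,
    compact B /\ forall x, B (h e x) /\ mdist x (h e x) < K * rho ^+ m e.
  by have [B ? ?] := hP e; exists B.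
apply: (@compact_nets _ _ B h).
- by move=> F UF; exact: completion_complete.
- by move=> e _; case: (BP e).
move=> e x e0; have [_ /(_ x)[? xh]] := BP e; split => //.
exact/ltW/(lt_trans xh)/mP.
Qed.

Lemma to_completion_dense_range (x : limit_space) (e : R) : 0 < e ->
  exists2 a, range (to_completion D) a & mdist a x < e.
Proof.
move=> /(to_completion_dense x)[c cx]; exists (to_completion D c) => //.
Qed.

(** Finitely many codes live in a single stage, which is tree-like and embeds isometrically. *)
Lemma limit_tree_like : tree_like limit_space.
Proof.
split.
  apply: four_point_dense to_completion_dense_range _.
  move=> _ _ _ _ [a _ <-] [b _ <-] [c _ <-] [e _ <-]; rewrite !mdist_to_completion.
  pose n := maxn (maxn (level a) (level b)) (maxn (level c) (level e)).
  have E u v : (level u <= n)%N -> (level v <= n)%N ->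
      D u v = mdist (point beta xi copy enum n u) (point beta xi copy enum n v).
    by move=> un vn; rewrite mdist_point.
  rewrite !E ?leq_max ?leqnn ?orbT//.
  exact: (stage_tree_like _ _ _ _ n).1.
apply: has_between_dense limit_compact to_completion_dense_range _.
move=> _ _ s [a _ <-] [b _ <-]; pose n := maxn (level a) (level b).
have an : (level a <= n)%N by rewrite leq_maxl.
have bn : (level b <= n)%N by rewrite leq_maxr.
have [f [fi fc]] := stage_embedding n.
rewrite -!fc// fi => /(stage_tree_like _ _ _ _ n).2[z za zb].
by exists (f z); rewrite fi.
Qed.

Lemma limit_compact_real_tree : is_compact_real_tree limit_space.
Proof. exact: compact_tree_like limit_tree_like limit_compact. Qed.

Lemma limit_rational_code_dense (x : limit_space) (e : R) : 0 < e ->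
  exists k, mdist (to_completion D (rational_code k) : limit_space) x < e.
Proof.
move=> e0; have e20 : 0 < e / 2 by rewrite divr_gt0.
have [c cx] := to_completion_dense x e20.
have [k kc] := rational_code_dense beta xi copy enum c e20; exists k.
have := metric_triangle (to_completion D (rational_code k)) (to_completion D c) x.
have {}kc : D (rational_code k) c < e / 2 := kc.
by rewrite mdist_to_completion; lra.
Qed.

End limit.

(** * Measurability of the stages *)

Section measurable_stages.
Context {R : realType} {d : measure_display} {Omega : measurableType d}.

(** Handles the random enumerations: on each event where the indices are known, the quantity is
    given by a fixed formula. *)
Lemma measurable_fun_cases (I : countType) (f : Omega -> R) (h : Omega -> I)
    (g : I -> Omega -> R) :
  (forall q, measurable [set w | h w = q]) ->
  (forall q, measurable_fun setT (g q)) ->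
  (forall w, f w = g (h w) w) -> measurable_fun setT f.
Proof.
move=> mh mg fg _ B mB; rewrite setTI.
have -> : f @^-1` B = \bigcup_q ([set w | h w = q] `&` g q @^-1` B).
  apply/seteqP; split=> [w Bw|w [q _ [/= <-]]]; last by rewrite /= fg.
  by exists (h w) => //; split => //=; rewrite -fg.
apply: countable_bigcupT_measurable; first exact: countableP.
by move=> q; apply: measurableI => //; rewrite -[X in measurable X]setTI; exact: mg.
Qed.

Lemma measurable_coordinate (f : bead_string R -> R) :
  (forall B, measurable B -> coordinate_events (f @^-1` B)) -> measurable_fun setT f.
Proof. by move=> H _ B mB; rewrite setTI; apply: sub_gen_smallest; exact: H. Qed.

Lemma measurable_len : measurable_fun setT (@len R).
Proof. by apply: measurable_coordinate => B mB; exists B => //; apply: Or31. Qed.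

Lemma measurable_loc i : measurable_fun setT (fun s : bead_string R => loc s i).
Proof.
by apply: measurable_coordinate => B mB; exists B => //; apply: Or32; exists i.
Qed.

Lemma measurable_mass i : measurable_fun setT (fun s : bead_string R => mass s i).
Proof.
by apply: measurable_coordinate => B mB; exists B => //; apply: Or33; exists i.
Qed.

Variables (beta : R) (xi : Omega -> bead_string R)
  (copy : nat -> nat -> Omega -> bead_string R) (enum : nat -> Omega -> nat -> nat * nat).
Notation T w := (stage beta (xi w) (fun m i => copy m i w) (fun m => enum m w)).
Notation L n k w :=
  (branch_len beta (xi w) (fun m i => copy m i w) (fun m => enum m w) n k).

Hypothesis mxi : measurable_fun setT xi.

Definition measurable_before n :=
  (forall m i, (m < n)%N -> measurable_fun setT (copy m i)) /\
  (forall m k q, (m < n)%N -> measurable [set w | enum m w k = q]).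

Lemma measurable_beforeW n : measurable_before n.+1 -> measurable_before n.
Proof. by move=> [mc me]; split=> *; [apply: mc|apply: me]; exact: ltnW. Qed.

Lemma measurable_atom_mass n k : measurable_before n ->
  measurable_fun setT (fun w => atom_mass (T w n) k).
Proof.
elim: n k => [|n IH] k mb.
  exact: (measurableT_comp (measurable_mass k) mxi).
apply: (@measurable_fun_cases _ _ (fun w => enum n w k)
  (fun q w => atom_mass (T w n) q.1 * mass (copy n q.1 w) q.2)).
- by move=> q; exact: mb.2.
- move=> q; apply: measurable_funM; first exact/IH/measurable_beforeW.
  by apply: (measurableT_comp (measurable_mass _)); exact: mb.1.
- by move=> w /=; case: (enum n w k).
Qed.

Lemma measurable_scale n i : measurable_before n ->
  measurable_fun setT (fun w => atom_mass (T w n) i `^ beta).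
Proof.
by move=> mb; apply: (measurableT_comp (measurable_powR beta)); exact: measurable_atom_mass.
Qed.

Lemma measurable_branch_len n i : measurable_before n.+1 ->
  measurable_fun setT (fun w => L n i w).
Proof.
move=> mb; apply: measurable_funM; first exact/measurable_scale/measurable_beforeW.
by apply: (measurableT_comp measurable_len); exact: mb.1.
Qed.

(** The induction on stages needs codes and atoms together, because distances in the next stage
    involve the branching points, which are atoms. *)
Definition marked_point n w (a : code R + nat) : T w n :=
  match a with
  | inl c => point beta (xi w) (fun m i => copy m i w) (fun m => enum m w) n c
  | inr k => @atom_loc R (T w n) k
  end.

(** Only the height on a branch is random here, not the index of the branch. *)
Definition glued_point n w (a : (code R + nat) + nat * (Omega -> R)) : T w n.+1 :=
  match a with
  | inl b => old_point _ _ (marked_point n w b)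
  | inr (i, r) => new_point (@atom_loc R (T w n)) (fun i => L n i w) i (r w)
  end.

Definition height_ok n (a : (code R + nat) + nat * (Omega -> R)) : Prop :=
  if a is inr (i, r) then
    measurable_fun setT r /\ forall w, 0 <= r w <= L n i w
  else True.

Lemma measurable_glued_point n a b :
  (forall a b, measurable_fun setT (fun w => mdist (marked_point n w a) (marked_point n w b))) ->
  height_ok n a -> height_ok n b ->
  measurable_fun setT (fun w => mdist (glued_point n w a) (glued_point n w b)).
Proof.
move=> IH; case: a b => [a|[i r]] [b|[j s]] /=.
- by move=> _ _; exact: IH.
- move=> _ [ms sl]; under eq_fun do rewrite mdist_old_new//.
  by apply: measurable_funD => //; exact: (IH a (inr j)).
- move=> [mr rl] _; under eq_fun do rewrite mdist_new_old//.
  by apply: measurable_funD => //; exact: (IH b (inr i)).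
move=> [mr rl] [ms sl]; have [ij|ij] := eqVneq i j.
  subst j; under eq_fun do rewrite mdist_new_same//.
  by apply: measurableT_comp; [exact: normr_measurable|exact: measurable_funB].
under eq_fun do rewrite mdist_new_diff//.
apply: measurable_funD => //; apply: measurable_funD => //.
exact: (IH (inr i) (inr j)).
Qed.

Lemma measurable_marked_point n a b : measurable_before n ->
  measurable_fun setT (fun w => mdist (marked_point n w a) (marked_point n w b)).
Proof.
elim: n a b => [|n IH] a b mb.
  pose h (a : code R + nat) w := match a with
    inl c => ratio c * len (xi w) | inr k => loc (xi w) k end.
  have hE a' w : val (marked_point 0 w a') = h a' w.
    case: a' => [c|k] //=; rewrite clip_id//.
    exact/ratio_mul/ltW/len_gt0.
  have mh a' : measurable_fun setT (h a').
    case: a' => [c|k] /=; last exact: (measurableT_comp (measurable_loc k)).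
    apply: measurable_funM => //; exact: (measurableT_comp measurable_len).
  under eq_fun do rewrite mdist_segment !hE.
  by apply: measurableT_comp; [exact: normr_measurable|exact: measurable_funB].
have mb' := measurable_beforeW mb.
(* [idx] isolates the value of the enumeration; once it is fixed to [q], [desc] describes the point
   with a deterministic branch. Codes do not use it and get a constant. *)
pose idx (a : code R + nat) w : nat * nat := if a is inr k then enum n w k else (0, 0)%N.
pose desc (a : code R + nat) (q : nat * nat) : (code R + nat) + nat * (Omega -> R) :=
  match a with
  | inl c => if (level c <= n)%N then inl (inl c)
             else inr (c.1.2, fun w => ratio c * L n c.1.2 w)
  | inr k => inr (q.1, fun w => atom_mass (T w n) q.1 `^ beta * loc (copy n q.1 w) q.2)
  end.
have descE a' w : marked_point n.+1 w a' = glued_point n w (desc a' (idx a' w)).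
  case: a' => [c|k] /=; first by case: ifP.
  by case: (enum n w k).
have midx a' q : measurable [set w | idx a' w = q].
  case: a' => [c|k] /=; last exact: mb.2.
  have [<-|nq] := pselect ((0, 0)%N = q).
    rewrite (_ : [set _ | _] = setT); first exact: measurableT.
    by apply/seteqP; split.
  rewrite (_ : [set _ | _] = set0); first exact: measurable0.
  by apply/seteqP; split.
have desc_ok a' q : height_ok n (desc a' q).
  case: a' => [c|k] /=.
    case: ifP => //= _; split.
      by apply: measurable_funM => //; exact: measurable_branch_len.
    by move=> w; apply: ratio_mul; exact: branch_len_ge0.
  split.
    apply: measurable_funM; first exact: measurable_scale.
    by apply: (measurableT_comp (measurable_loc _)); exact: mb.1.
  move=> w; have /andP[l0 l1] := loc_itv (copy n q.1 w) q.2.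
  by rewrite mulr_ge0 ?powR_ge0//= ler_wpM2l ?powR_ge0.
apply: (@measurable_fun_cases _ _ (fun w => (idx a w, idx b w))
  (fun q w => mdist (glued_point n w (desc a q.1)) (glued_point n w (desc b q.2)))).
- move=> [q q']; rewrite (_ : [set _ | _] =
    [set w | idx a w = q] `&` [set w | idx b w = q']); first exact: measurableI.
  by apply/seteqP; split => w /= [-> ->].
- by move=> q; apply: measurable_glued_point => // a' b'; exact: IH.
- by move=> w; rewrite !descE.
Qed.

Lemma measurable_code_dist c c' : (forall n, measurable_before n) ->
  measurable_fun setT (fun w =>
    code_dist beta (xi w) (fun m i => copy m i w) (fun m => enum m w) c c').
Proof.
by move=> mb; exact: (@measurable_marked_point (maxn (level c) (level c')) (inl c) (inl c')).
Qed.

End measurable_stages.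

(** * Moments *)

Section independence.
Context {R : realType} {d : measure_display} {Omega : measurableType d}.
Variable P : probability Omega R.
Local Open Scope ereal_scope.

(** The law of the pair agrees with the product law on rectangles, hence equals it, and Tonelli
    applies. *)
Lemma integral_prod_independent (X Y : Omega -> R) :
  measurable_fun setT X -> measurable_fun setT Y ->
  (forall w, 0 <= X w)%R -> (forall w, 0 <= Y w)%R ->
  (forall A B, measurable A -> measurable B ->
    P (X @^-1` A `&` Y @^-1` B) = P (X @^-1` A) * P (Y @^-1` B)) ->
  \int[P]_w (X w * Y w)%:E = (\int[P]_w (X w)%:E) * (\int[P]_w (Y w)%:E).
Proof.
move=> mX mY X0 Y0 XY.
have mZ : measurable_fun setT (fun w => (X w, Y w)) by exact: measurable_fun_pair.
pose X' : {RV P >-> R} := mfun_Sub (mem_set mX).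
pose Y' : {RV P >-> R} := mfun_Sub (mem_set mY).
pose Z' : {RV P >-> (R * R)%type} := mfun_Sub (mem_set mZ).
(* The identity on the values of [X] and [Y], made nonnegative on the whole line as the integrals
   against the laws require. *)
pose a (r : R) : R := `|r|%R.
have a0 r : (0 <= a r)%R by exact: normr_ge0.
have aid r : (0 <= r)%R -> a r = r by exact: ger0_norm.
have ma : measurable_fun setT a by exact: normr_measurable.
have maE : measurable_fun setT (EFin \o a) by exact/measurable_EFinP.
pose m (z : R * R) : R := (a z.1 * a z.2)%R.
have mm : measurable_fun setT (EFin \o m).
  by apply/measurable_EFinP; apply: measurable_funM; exact: measurableT_comp.
have EX (U : Omega -> R) (mU : measurable_fun setT U) : (forall w, 0 <= U w)%R ->
    \int[P]_w (U w)%:E = \int[distribution P (mfun_Sub (mem_set mU) : {RV P >-> R})]_x (a x)%:E.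
  move=> U0; rewrite ge0_integral_distribution//.
  by apply: eq_integral => w _ /=; rewrite aid.
rewrite (EX _ mX X0) (EX _ mY Y0).
have -> : \int[P]_w (X w * Y w)%:E = \int[distribution P Z']_z (m z)%:E.
  rewrite ge0_integral_distribution//; last by move=> z; rewrite lee_fin mulr_ge0.
  by apply: eq_integral => w _ /=; rewrite /m/= !aid.
have -> : \int[distribution P Z']_z (m z)%:E =
    \int[distribution P X' \x distribution P Y']_z (m z)%:E.
  apply: eq_measure_integral => A mA _.
  by apply/esym; apply: product_measure_unique => // B C mB mC; exact: XY.
rewrite fubini_tonelli1//=; last by move=> z; rewrite lee_fin mulr_ge0.
rewrite /fubini_F /=.
have cY0 : 0 <= \int[distribution P Y']_y (a y)%:E.
  by apply: integral_ge0 => y _; rewrite lee_fin.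
rewrite -ge0_integralZr//; last by move=> x _; exact: a0.
apply: eq_integral => x _ /=.
rewrite -ge0_integralZl//; [by move=> y _; exact: a0|exact: a0].
Qed.

End independence.

Section moments.
Context {R : realType} {d : measure_display} {Omega : measurableType d}.
Variables (P : probability Omega R) (beta p : R).
Variables (xi : {mfun Omega >-> bead_string R})
  (copy : nat -> nat -> {mfun Omega >-> bead_string R})
  (enum : nat -> Omega -> nat -> nat * nat).
Hypothesis enumP : random_enumerations enum.
Hypothesis copyP : fresh_copies P xi copy enum.
Local Open Scope ereal_scope.

Notation T w := (stage beta (xi w) (fun m i => copy m i w) (fun m => enum m w)).
Notation L n k w :=
  (branch_len beta (xi w) (fun m i => copy m i w) (fun m => enum m w) n k).
Notation pastn := (past xi copy enum).

Lemma measurable_before_all n :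
  @measurable_before R _ Omega (fun m i => copy m i : Omega -> bead_string R) enum n.
Proof. by split=> *; [exact: measurable_funPT|exact: enumP.2]. Qed.

Let gen n : set (set Omega) := [set A |
    [\/ exists2 E, measurable E & A = xi @^-1` E,
        exists m i, (m < n)%N /\ exists2 E, measurable E & A = copy m i @^-1` E |
        exists m k q, (m < n)%N /\ A = [set w | enum m w k = q]]].

(** This is [measurable_atom_mass] again, with [Omega] carrying the sigma-algebra of the past
    instead of its own. *)
Lemma past_atom_mass n k B : measurable B -> pastn n ((fun w => atom_mass (T w n) k) @^-1` B).
Proof.
move=> mB; rewrite -[X in pastn n X]setTI.
apply: (@measurable_atom_mass R _ (g_sigma_algebraType (gen n)) beta xi
  (fun m i => copy m i) enum) => //.
- by move=> _ E mE; rewrite setTI; apply: sub_gen_smallest; apply: Or31; exists E.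
split=> [m i mn _ E mE|m j q mn].
  by rewrite setTI; apply: sub_gen_smallest; apply: Or32; exists m, i; split => //; exists E.
by apply: sub_gen_smallest; apply: Or33; exists m, j, q.
Qed.

Lemma copy_independent n i A E : pastn n A -> measurable E ->
  P (A `&` copy n i @^-1` E) = P A * P (copy n i @^-1` E).
Proof.
move=> pA mE.
(* All events but the [i]-th are full, so only one factor of the product remains. *)
pose F j := if j == i then E else setT.
have mF j : measurable (F j) by rewrite /F; case: ifP.
have := copyP.2 n A i.+1 F pA mF.
have Fi : F i = E by rewrite /F eqxx.
have Fj (j : 'I_i) : F j = setT by rewrite /F ltn_eqF.
rewrite !big_ord_recr /= Fi big1; last by move=> j _; rewrite Fj preimage_setT.
rewrite setTI big1 ?mul1e// => j _.
by rewrite Fj preimage_setT probability_setT.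
Qed.

Lemma integral_copy n i (f : bead_string R -> R) : measurable_fun setT f ->
  (forall s, 0 <= f s)%R ->
  \int[P]_w (f (copy n i w))%:E = \int[P]_w (f (xi w))%:E.
Proof.
move=> mf f0.
have mfE : measurable_fun setT (EFin \o f) by exact/measurable_EFinP.
rewrite -(@ge0_integral_distribution _ _ _ _ _ P (copy n i) (EFin \o f))//.
rewrite -(@ge0_integral_distribution _ _ _ _ _ P xi (EFin \o f))//.
by apply: eq_measure_integral => A mA _; exact: copyP.1.
Qed.

Lemma integral_atom_copy n k i (s : R) (f : bead_string R -> R) :
  measurable_fun setT f -> (forall s, 0 <= f s)%R ->
  \int[P]_w (atom_mass (T w n) k `^ s * f (copy n i w))%:E =
  \int[P]_w (atom_mass (T w n) k `^ s)%:E * \int[P]_w (f (xi w))%:E.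
Proof.
move=> mf f0; rewrite -(integral_copy n i)//.
apply: integral_prod_independent => //.
- apply: (measurableT_comp (measurable_powR s)).
  by apply: measurable_atom_mass; [exact: measurable_funPT|exact: measurable_before_all].
- exact: measurableT_comp.
- by move=> w; exact: powR_ge0.
move=> A B mA mB.
have mA' : measurable ((@powR R ^~ s) @^-1` A).
  by rewrite -[X in measurable X]setTI; exact: measurable_powR.
have mB' : measurable (f @^-1` B) by rewrite -[X in measurable X]setTI; exact: mf.
exact: (copy_independent i (past_atom_mass k mA') mB').
Qed.

Lemma atom_mass_ge0 n k w : (0 <= atom_mass (T w n) k)%R.
Proof.
elim: n k => [|n IH] k; first exact: mass_ge0.
by rewrite /=; case: (enum n w k) => i j; rewrite mulr_ge0// mass_ge0.
Qed.

Local Notation s := (p * beta)%R.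
Local Notation xi_moment := (\int[P]_w (\sum_(0 <= j <oo) ((mass (xi w) j `^ s)%R)%:E)).
Local Notation stage_moment n := (\sum_(0 <= k <oo) \int[P]_w (atom_mass (T w n) k `^ s)%:E).

Lemma measurable_stage_atom n k : measurable_fun setT (fun w => (atom_mass (T w n) k `^ s)%:E).
Proof.
apply/measurable_EFinP; apply: (measurableT_comp (measurable_powR s)).
by apply: measurable_atom_mass; [exact: measurable_funPT|exact: measurable_before_all].
Qed.

Lemma measurable_massR j : measurable_fun setT (fun x : bead_string R => mass x j `^ s)%R.
Proof. exact: (measurableT_comp (measurable_powR s) (measurable_mass j)). Qed.

Lemma measurable_lenR : measurable_fun setT (fun x : bead_string R => len x `^ p)%R.
Proof. exact: (measurableT_comp (measurable_powR p) measurable_len). Qed.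

Lemma stage_moment0 : stage_moment 0 = xi_moment.
Proof.
rewrite integral_nneseries//; last by move=> *; rewrite lee_fin powR_ge0.
by move=> n; exact: (@measurable_stage_atom 0 n).
Qed.

(** The enumeration is a bijection onto the pairs, and nonnegative terms may be summed in any
    order. *)
Lemma stage_sumS n w : \sum_(0 <= k <oo) (atom_mass (T w n.+1) k `^ s)%:E =
  \sum_(0 <= i <oo) \sum_(0 <= j <oo)
    ((atom_mass (T w n) i `^ s) * (mass (copy n i w) j `^ s))%:E.
Proof.
pose F (q : nat * nat) : \bar R :=
  ((atom_mass (T w n) q.1 `^ s) * (mass (copy n q.1 w) q.2 `^ s))%:E.
have F0 q : 0 <= F q by rewrite lee_fin mulr_ge0// powR_ge0.
have -> : \sum_(0 <= k <oo) (atom_mass (T w n.+1) k `^ s)%:E =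
    \sum_(0 <= k <oo) F (enum n w k).
  apply: eq_eseriesr => k _; rewrite /F /=; case: (enum n w k) => i j /=.
  by rewrite powRM// ?mass_ge0// atom_mass_ge0.
rewrite nneseries_esumT//.
rewrite -(@reindex_esum _ _ _ setT setT (enum n w) F); last first.
  by rewrite setTT_bijective; exact: enumP.1.
rewrite nneseries_esumT; last by move=> i; apply: nneseries_ge0 => j _ _; exact: (F0 (i, j)).
transitivity (\esum_(i in setT) \esum_(j in setT) F (i, j)); last first.
  by apply: eq_esum => i _; rewrite nneseries_esumT// => j; exact: (F0 (i, j)).
rewrite esum_esum; last by move=> i j _ _; exact: F0.
rewrite (_ : _ `*`` _ = setT); first by apply: eq_esum => -[i j].
by apply/seteqP; split.
Qed.

Lemma nneseries_ge_term (f : nat -> \bar R) i : (forall k, 0 <= f k) ->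
  f i <= \sum_(0 <= k <oo) f k.
Proof.
move=> f0; apply: le_trans (nneseries_lim_ge i.+1 _) => //.
by rewrite big_nat_recr//= leeDr// sume_ge0.
Qed.

Lemma integral_stage_atom_ge0 n k : 0 <= \int[P]_w (atom_mass (T w n) k `^ s)%:E.
Proof. by apply: integral_ge0 => w _; rewrite lee_fin powR_ge0. Qed.

(** A mass is multiplied by masses of an independent copy, so each atom of stage [n] contributes its
    own moment times [mu]. *)
Lemma stage_momentS n (mu m : R) : xi_moment = mu%:E -> stage_moment n = m%:E ->
  stage_moment n.+1 = (mu * m)%:E.
Proof.
move=> xmu nm.
rewrite -integral_nneseries//; last by move=> *; rewrite lee_fin powR_ge0.
  2: by move=> k; exact: measurable_stage_atom.
under eq_integral do rewrite stage_sumS.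
have mm i j : measurable_fun setT (fun w =>
    ((atom_mass (T w n) i `^ s) * (mass (copy n i w) j `^ s))%:E).
  apply/measurable_EFinP; apply: measurable_funM.
    exact/measurable_EFinP/measurable_stage_atom.
  exact: (measurableT_comp (measurable_massR j)).
have m0 i j w : 0 <= ((atom_mass (T w n) i `^ s) * (mass (copy n i w) j `^ s))%:E.
  by rewrite lee_fin mulr_ge0// powR_ge0.
rewrite integral_nneseries//; last first.
- by move=> i w _; apply: nneseries_ge0.
- by move=> i; apply: ge0_emeasurable_sum => //.
rewrite EFinM -nm -nneseriesZl; last by move=> i _; exact: integral_stage_atom_ge0.
apply: eq_eseriesr => i _; rewrite integral_nneseries//.
(* A term of a series with finite sum; being finite, it can be pulled out as a real factor. *)
have fin_i : \int[P]_w (atom_mass (T w n) i `^ s)%:E \is a fin_num.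
  rewrite ge0_fin_numE ?integral_stage_atom_ge0//.
  apply: le_lt_trans (ltry m); rewrite -nm.
  exact: (nneseries_ge_term i (integral_stage_atom_ge0 n)).
transitivity (\sum_(0 <= j <oo) ((fine (\int[P]_w (atom_mass (T w n) i `^ s)%:E))%:E *
    \int[P]_w (mass (xi w) j `^ s)%:E)).
  apply: eq_eseriesr => j _; rewrite fineK//.
  exact: (integral_atom_copy n i i s (measurable_massR j) (fun x => powR_ge0 _ _)).
rewrite nneseriesZl; last by move=> j _; apply: integral_ge0 => w _; rewrite lee_fin powR_ge0.
rewrite fineK// muleC; congr (_ * _).
rewrite -xmu integral_nneseries//.
- move=> j; apply/measurable_EFinP.
  exact: (measurableT_comp (measurable_massR j)).
- by move=> j w _; rewrite lee_fin powR_ge0.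
Qed.

Lemma stage_moment_pow n (mu : R) : xi_moment = mu%:E ->
  stage_moment n = (mu ^+ n.+1)%:E.
Proof.
move=> xmu; elim: n => [|n IH]; first by rewrite stage_moment0 xmu expr1.
by rewrite (stage_momentS xmu IH) -exprS.
Qed.

Local Notation Y n w := (\sum_(0 <= i <oo) ((L n i w `^ p)%R)%:E).

(** The origin of the exponent [p * beta]: a mass enters the length with power [beta], and the
    length is raised to the power [p]. *)
Lemma branch_len_pow n i w :
  (L n i w `^ p = atom_mass (T w n) i `^ s * len (copy n i w) `^ p)%R.
Proof.
rewrite /branch_len powRM ?powR_ge0 ?(ltW (len_gt0 _))//.
by rewrite -powRrM [(beta * p)%R]mulrC.
Qed.

Lemma measurable_branch_len_pow n i :
  measurable_fun setT (fun w => (L n i w `^ p)%:E).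
Proof.
apply/measurable_EFinP; apply: (measurableT_comp (measurable_powR p)).
by apply: measurable_branch_len; [exact: measurable_funPT|exact: measurable_before_all].
Qed.

Lemma integral_branch_len n (mu lp : R) : xi_moment = mu%:E ->
  \int[P]_w (len (xi w) `^ p)%:E = lp%:E ->
  \int[P]_w (Y n w) = (lp * mu ^+ n.+1)%:E.
Proof.
move=> xmu xlp; rewrite integral_nneseries//; last first.
- by move=> *; rewrite lee_fin powR_ge0.
- by move=> i; exact: measurable_branch_len_pow.
rewrite EFinM -(stage_moment_pow n xmu) -nneseriesZl; last first.
  by move=> i _; exact: integral_stage_atom_ge0.
apply: eq_eseriesr => i _; under eq_integral do rewrite branch_len_pow.
by rewrite (integral_atom_copy n i i s measurable_lenR (fun x => powR_ge0 _ _)) xlp muleC.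
Qed.

(** The expectation of [Z] is the geometric series of ratio [mu / r] with first term [lp * mu]. *)
Lemma branch_len_summable (mu lp r : R) : xi_moment = mu%:E ->
  \int[P]_w (len (xi w) `^ p)%:E = lp%:E -> (0 < r)%R -> (mu < r)%R ->
  let Z w := \sum_(0 <= n <oo) ((r ^- n)%:E * Y n w) in
  measurable_fun setT Z /\ \int[P]_w Z w < +oo.
Proof.
move=> xmu xlp r0 mur Z.
have Y0 n w : 0 <= Y n w by apply: nneseries_ge0 => *; rewrite lee_fin powR_ge0.
have mY n : measurable_fun setT (fun w => Y n w).
  apply: ge0_emeasurable_sum => // k *; [by rewrite lee_fin powR_ge0|].
  exact: measurable_branch_len_pow.
have rn0 n : (0 <= r ^- n)%R by rewrite invr_ge0 exprn_ge0// ltW.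
have mrY n : measurable_fun setT (fun w => (r ^- n)%:E * Y n w).
  exact: measurable_funeM.
have rY0 n w : 0 <= (r ^- n)%:E * Y n w by apply: mule_ge0; [rewrite lee_fin|exact: Y0].
split; first by apply: ge0_emeasurable_sum.
rewrite integral_nneseries//.
have mu0 : (0 <= mu)%R.
  rewrite -lee_fin -xmu; apply: integral_ge0 => w _; apply: nneseries_ge0 => j _ _.
  by rewrite lee_fin powR_ge0.
have E n : (r ^- n * (lp * mu ^+ n.+1) = (lp * mu) * (mu / r) ^+ n)%R.
  by rewrite exprS expr_div_n; ring.
rewrite (_ : (\sum_(0 <= n <oo) _) = \sum_(0 <= n <oo) (lp * mu * (mu / r) ^+ n)%:E); last first.
  apply: eq_eseriesr => n _; rewrite -E EFinM -(integral_branch_len n xmu xlp).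
  by apply: ge0_integralZl => //; rewrite lee_fin.
have z0 : (0 <= mu / r)%R by rewrite divr_ge0// ltW.
have z1 : (mu / r < 1)%R by rewrite ltr_pdivrMr// mul1r.
have a0 : (0 <= lp * mu)%R.
  rewrite mulr_ge0// -lee_fin -xlp; apply: integral_ge0 => w _.
  by rewrite lee_fin powR_ge0.
apply: (@le_lt_trans _ _ ((lp * mu / (1 - mu / r))%:E)); last exact: ltry.
apply: lime_le.
  by apply: is_cvg_nneseries => n _ _; rewrite lee_fin mulr_ge0// exprn_ge0.
apply: nearW => N; rewrite sumEFin lee_fin.
have := @geometric_seriesE R (lp * mu)%R (mu / r)%R.
rewrite lt_eqF// => /(_ isT)/(congr1 (fun f => f N)); rewrite /series /= => ->.
by rewrite ler_wpM2r ?invr_ge0 ?subr_ge0 ?(ltW z1)// ler_piMr// gerBl exprn_ge0.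
Qed.

End moments.

(** * Almost sure convergence *)

Section geometric_decay.
Context {R : realType}.
Variables (l : nat -> nat -> R) (p r : R).
Hypotheses (l0 : forall n i, 0 <= l n i) (p0 : 0 < p) (r0 : 0 < r) (r1 : r < 1).
Hypothesis lr : (\sum_(0 <= n <oo) ((r ^- n)%:E * \sum_(0 <= i <oo) (l n i `^ p)%:E) < +oo)%E.

Local Notation Y n := (\sum_(0 <= i <oo) (l n i `^ p)%:E)%E.

Let Y0 n : (0 <= Y n)%E.
Proof. by apply: nneseries_ge0 => *; rewrite lee_fin powR_ge0. Qed.

Let rn0 n : 0 < r ^- n. Proof. by rewrite invr_gt0 exprn_gt0. Qed.

Let rY0 n : (0 <= (r ^- n)%:E * Y n)%E.
Proof. by apply: mule_ge0 => //; rewrite lee_fin ltW. Qed.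

Let Z := fine (\sum_(0 <= n <oo) ((r ^- n)%:E * Y n))%E.

Let Z0 : 0 <= Z.
Proof. by apply: fine_ge0; apply: nneseries_ge0. Qed.

Let YZ n : (Y n <= (Z * r ^+ n)%:E)%E.
Proof.
have : ((r ^- n)%:E * Y n <= Z%:E)%E.
  rewrite /Z fineK; first exact: (nneseries_ge_term n rY0).
  by rewrite ge0_fin_numE//; apply: nneseries_ge0.
by rewrite lee_pdivrMl ?exprn_gt0// -EFinM mulrC.
Qed.

Lemma decay_geometric : exists C rho : R,
  [/\ 0 < C, 0 < rho, rho < 1 & forall n i, l n i <= C * rho ^+ n].
Proof.
have q0 : 0 < p^-1 by rewrite invr_gt0.
(* Each term [l n i ^ p] is at most [Z * r ^ n]; taking roots gives both constants, and the 1
   ensures positivity when [Z] is 0. *)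
exists (Z `^ p^-1 + 1), (r `^ p^-1); split.
- by rewrite ltr_pwDr ?powR_ge0.
- exact: powR_gt0.
- have one : 1 `^ p^-1 = 1 :> R by rewrite powR1.
  rewrite -[ltRHS]one; apply: gt0_ltr_powR => //.
    by rewrite nnegrE ltW.
  by rewrite nnegrE.
move=> n i.
have lZ : l n i `^ p <= Z * r ^+ n.
  rewrite -lee_fin; apply: le_trans (YZ n).
  apply: (@nneseries_ge_term _ (fun i => (l n i `^ p)%:E)) => k.
  by rewrite lee_fin powR_ge0.
have lE : l n i = (l n i `^ p) `^ p^-1 by rewrite -powRrM divff ?lt0r_neq0// powRr1.
rewrite [leLHS]lE.
apply: (@le_trans _ _ ((Z * r ^+ n) `^ p^-1)).
  apply: ge0_ler_powR; rewrite ?nnegrE ?powR_ge0 ?(ltW q0)//.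
  by rewrite mulr_ge0// exprn_ge0// ltW.
have E : (r ^+ n) `^ p^-1 = (r `^ p^-1) ^+ n.
  rewrite -(powR_mulrn n (ltW r0)) powRAC.
  exact: powR_mulrn (powR_ge0 _ _).
rewrite powRM// ?exprn_ge0 ?(ltW r0)// E.
by rewrite ler_wpM2r ?exprn_ge0 ?powR_ge0// lerDl.
Qed.

(** Each term is at most the tail of the series that starts with it, and the tails tend to 0. *)
Lemma decay_cvg0 n e : 0 < e -> exists N, forall i, (N <= i)%N -> l n i < e.
Proof.
move=> e0; have Yoo : (Y n < +oo)%E by apply: le_lt_trans (YZ n) _; exact: ltry.
have f0 k : (0 <= (l n k `^ p)%:E)%E by rewrite lee_fin powR_ge0.
have /fine_cvgP[_ /cvgrPdist_lt] := nneseries_tail_cvg Yoo (fun k _ => f0 k).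
move=> /(_ (e `^ p)) []; first exact: powR_gt0.
move=> N _ HN; exists N => i /HN /=; rewrite sub0r normrN => tail.
rewrite ltNge; apply/negP => ei; move: tail; apply/negP; rewrite -leNgt.
apply: le_trans (ler_norm _).
apply: (@le_trans _ _ (l n i `^ p)).
  by apply: ge0_ler_powR; rewrite ?nnegrE ?(ltW e0) ?(ltW p0).
have t0 k : (0 <= \sum_(k <= j <oo) (l n j `^ p)%:E)%E by apply: nneseries_ge0.
rewrite -lee_fin fineK.
  have := @nneseries_lim_ge _ (fun j => (l n j `^ p)%:E) xpredT i i.+1 (fun k _ _ => f0 k).
  by rewrite big_nat1.
rewrite ge0_fin_numE//; apply: le_lt_trans Yoo.
rewrite (@nneseries_split _ (fun j => (l n j `^ p)%:E) 0%N i)//.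
by rewrite add0n leeDr// sume_ge0.
Qed.

End geometric_decay.

(** * Measurability of the limit *)

Section measurable_limit.
Context {R : realType} {d : measure_display} {Omega : measurableType d}.
Variables (D : Omega -> nat -> nat -> R).
Hypothesis mD : forall i j, measurable_fun setT (fun w => D w i j).

(* The distances between the first [N.+1] points, rounded to multiples of [e], when
   these points are [e / 2]-dense. *)
Definition distance_cell (e : R) (q : nat * seq (seq int)) : set Omega :=
  (\bigcap_j \bigcup_(i in [set i | (i <= q.1)%N]) [set w | D w i j < e / 2]) `&`
  \bigcap_i \bigcap_j [set w | (i <= q.1)%N -> (j <= q.1)%N ->
    D w i j \in `[(nth 0 (nth [::] q.2 i) j)%:~R * e, (nth 0 (nth [::] q.2 i) j + 1)%:~R * e[ ].

Lemma measurable_distance_cell e q : measurable (distance_cell e q).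
Proof.
have mI (I : interval R) i j : measurable [set w | D w i j \in I].
  by rewrite -[X in measurable X]setTI; exact: (mD i j measurableT (measurable_itv I)).
apply: measurableI; apply: bigcapT_measurable => i.
  apply: bigcup_measurable => j _.
  rewrite (_ : [set w | _] = [set w | D w j i \in `]-oo, e / 2[ ]); first exact: mI.
  by apply/seteqP; split => w /=; rewrite in_itv.
apply: bigcapT_measurable => j.
have [iq|iq] := boolP ((i <= q.1) && (j <= q.1))%N.
  rewrite (_ : mkset _ = [set w | D w i j \in `[(nth 0 (nth [::] q.2 i) j)%:~R * e,
     (nth 0 (nth [::] q.2 i) j + 1)%:~R * e[ ]); first exact: mI.
  move/andP: iq => [iq jq]; apply/seteqP; split => w /=; first exact.
  by [].
rewrite (_ : mkset _ = setT); first exact: measurableT.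
by apply/seteqP; split => // w _ /= iN jN; move: iq; rewrite iN jN.
Qed.

Lemma distance_cell_exists e w N : 0 < e ->
  (forall j, exists2 i, (i <= N)%N & D w i j < e / 2) ->
  exists q, distance_cell e q w.
Proof.
move=> e0 H.
exists (N, mkseq (fun i => mkseq (fun j => Num.floor (D w i j / e)) N.+1) N.+1).
split; first by move=> j _; have [i iN ij] := H j; exists i.
move=> i _ j _ /= iN jN; rewrite !nth_mkseq//.
have /andP[h1 h2] := floor_itv (D w i j / e).
by rewrite in_itv/= -ler_pdivlMr// h1 -ltr_pdivrMr.
Qed.

Lemma distance_cell_close e q w w' : 0 < e -> distance_cell e q w -> distance_cell e q w' ->
  forall i j, (i <= q.1)%N -> (j <= q.1)%N -> `|D w i j - D w' i j| <= e.
Proof.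
move=> e0 [_ H] [_ H'] i j iq jq.
have := H i I j I iq jq; have := H' i I j I iq jq; rewrite !in_itv/= intrD mulrDl mul1r.
by move=> /andP[? ?] /andP[? ?]; rewrite ler_norml; apply/andP; split; lra.
Qed.

End measurable_limit.

(** The value given to the limit on the negligible event where the lengths are not controlled. *)
Definition unit_tree (R : realType) : compact_real_tree R :=
  @CompactRealTree R (beaded_of_string (massless_unit_string R))
    (@compact_tree_like R (beaded_of_string (massless_unit_string R))
       (segment_tree_like (@ler01 R)) (segment_compact_space (@ler01 R))).

Section random_limit.
Context {R : realType} {d : measure_display} {Omega : measurableType d}.
Variables (beta : R) (xi : Omega -> bead_string R)
  (copy : nat -> nat -> Omega -> bead_string R) (enum : nat -> Omega -> nat -> nat * nat).
Hypothesis mxi : measurable_fun setT xi.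
Hypothesis mb : forall n, measurable_before copy enum n.
Variable G : set Omega.
Hypothesis mG : measurable G.

Local Notation X w := (limit_space beta (xi w) (fun m i => copy m i w) (fun m => enum m w)).

Hypothesis GX : forall w, G w -> is_compact_real_tree (X w).

Definition limit_tree w : compact_real_tree R :=
  match pselect (G w) with
  | left Gw => CompactRealTree (GX Gw)
  | right _ => unit_tree R
  end.

Lemma limit_treeE w : G w -> tree (limit_tree w) = X w.
Proof. by rewrite /limit_tree; case: pselect. Qed.

Lemma limit_tree_out w : ~ G w -> limit_tree w = unit_tree R.
Proof. by rewrite /limit_tree; case: pselect. Qed.

Hypothesis dense_codes : forall w (x : X w) (e : R), G w -> 0 < e -> exists k,
  mdist (to_completion _ (rational_code k) : X w) x < e.

Lemma random_limit_tree : random_tree limit_tree.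
Proof.
move=> U Uo.
have -> : [set w | U (limit_tree w)] =
    (G `&` [set w | U (limit_tree w)]) `|` (~` G `&` [set _ | U (unit_tree R)]).
  apply/seteqP; split => [w /= Uw|w /= [[]//|[Gw]]]; last by rewrite limit_tree_out.
  have [Gw|Gw] := pselect (G w); [by left|right].
  by split => //; rewrite -(limit_tree_out Gw).
apply: measurableU; last first.
  have [Uu|Uu] := pselect (U (unit_tree R)).
    by rewrite (_ : [set _ | _] = setT) ?setIT; [exact: measurableC|apply/seteqP; split].
  by rewrite (_ : [set _ | _] = set0) ?setI0; [exact: measurable0|apply/seteqP; split].
pose D w i j := code_dist beta (xi w) (fun m i => copy m i w) (fun m => enum m w)
  (rational_code i) (rational_code j).
have mD i j : measurable_fun setT (fun w => D w i j) by exact: measurable_code_dist.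
pose y w k : X w := to_completion _ (rational_code k).
have yD w i j : mdist (y w i) (y w j) = D w i j by rewrite mdist_to_completion.
apply: (@measurable_of_cells _ _ _ limit_tree G _ (distance_cell D)) => //.
- by move=> e q _; exact: measurable_distance_cell.
- move=> e w e0 Gw; have e20 : 0 < e / 2 by rewrite divr_gt0.
  have [N HN] := compact_finite_net (GX Gw).2 (fun x e => @dense_codes w x e Gw) e20.
  apply: (distance_cell_exists (N := N)) => // j.
  by have [i iN ij] := HN (y w j); exists i => //; rewrite -yD.
move=> e q w w' e0 Gw Gw' wq wq'.
rewrite !limit_treeE//.
(* The cell provides [e / 2]-density among the rational codes only; their own density accounts for
   the other [e / 2]. *)
have net v : G v -> distance_cell D e q v ->
    forall x : X v, exists2 i, (i <= q.1)%N & mdist (y v i) x <= e.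
  move=> Gv [vq _] x; have e20 : 0 < e / 2 by rewrite divr_gt0.
  have [j jx] := dense_codes x Gv e20; have [i iq ij] := vq j I.
  exists i => //; have := metric_triangle (y v i) (y v j) x.
  by rewrite yD; move: ij jx => /= ? ?; lra.
apply: (@gh_dist_nets _ (X w) (X w') q.1 (y w) (y w')) => //.
- exact: net.
- exact: net.
by move=> i j iq jq; rewrite !yD; exact: distance_cell_close iq jq.
Qed.

End random_limit.

Theorem theorem1p7 (R : realType) (d : measure_display) (Omega : measurableType d)
    (P : probability Omega R) (beta p : R)
    (xi : {mfun Omega >-> bead_string R})
    (copy : nat -> nat -> {mfun Omega >-> bead_string R})
    (enum : nat -> Omega -> nat -> nat * nat)
    (beta_gt0 : 0 < beta) (p_ge1 : 1 <= p)
    (len_moment : ('E_P[(fun w => len (xi w) `^ p)%R] < +oo)%E)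
    (mass_moment :
      (\int[P]_w (\sum_(0 <= j <oo) ((mass (xi w) j `^ (p * beta))%R)%:E) < 1)%E)
    (enumP : random_enumerations enum)
    (copyP : fresh_copies P xi copy enum) :
  let T n w := stage beta (xi w) (fun m i => copy m i w) (fun m => enum m w) n in
  exists Tlim : Omega -> compact_real_tree R,
    random_tree Tlim /\
    {ae P, forall w, (forall n, is_compact_real_tree (T n w)) /\
                     gh_dist (T n w) (Tlim w) @[n --> \oo] --> 0%E}.
Proof.
move=> T.
have p0 : 0 < p by lra.
have [mu xmu] : exists mu : R,
    (\int[P]_w (\sum_(0 <= j <oo) ((mass (xi w) j `^ (p * beta))%R)%:E))%E = mu%:E.
  exists (fine (\int[P]_w (\sum_(0 <= j <oo) ((mass (xi w) j `^ (p * beta))%R)%:E))%E).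
  rewrite fineK// ge0_fin_numE ?(lt_trans mass_moment) ?ltry//.
  by apply: integral_ge0 => w _; apply: nneseries_ge0 => *; rewrite lee_fin powR_ge0.
have mu1 : mu < 1 by rewrite -lte_fin -xmu.
have mu0 : 0 <= mu.
  rewrite -lee_fin -xmu; apply: integral_ge0 => w _.
  by apply: nneseries_ge0 => *; rewrite lee_fin powR_ge0.
have [lp xlp] : exists lp : R, (\int[P]_w (len (xi w) `^ p)%:E)%E = lp%:E.
  move: len_moment; rewrite unlock => loo.
  exists (fine (\int[P]_w (len (xi w) `^ p)%:E)%E); rewrite fineK// ge0_fin_numE//.
  by apply: integral_ge0 => w _; rewrite lee_fin powR_ge0.
(* Any value strictly between [mu] and 1: above [mu] the weighted series has finite expectation,
   below 1 the lengths decay. *)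
pose r := (1 + mu) / 2.
have r0 : 0 < r by rewrite /r; lra.
have r1 : r < 1 by rewrite /r; lra.
have mur : mu < r by rewrite /r; lra.
have [mZ Zoo] := branch_len_summable enumP copyP xmu xlp r0 mur.
pose L w n k := branch_len beta (xi w) (fun m i => copy m i w) (fun m => enum m w) n k.
pose Z w := (\sum_(0 <= n <oo) ((r ^- n)%:E * \sum_(0 <= i <oo) (L w n i `^ p)%:E))%E.
pose G := [set w | (Z w < +oo)%E].
have Z0 w : (0 <= Z w)%E.
  apply: nneseries_ge0 => n _ _; apply: mule_ge0.
    by rewrite lee_fin invr_ge0 exprn_ge0// ltW.
  by apply: nneseries_ge0 => *; rewrite lee_fin powR_ge0.
have mG : measurable G.
  rewrite (_ : G = ~` (Z @^-1` [set +oo%E])).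
    apply: measurableC; rewrite -[X in measurable X]setTI.
    exact: (mZ measurableT _ (emeasurable_set1 _)).
  apply/seteqP; split => w /=; first by move=> + E; rewrite /G/= E ltxx.
  by move=> /eqP; rewrite /G/= lt_neqAle leey andbT.
have L0 w n i : 0 <= L w n i by exact: branch_len_ge0.
have Lgeo w (Gw : G w) := decay_geometric (L0 w) p0 r0 r1 Gw.
have Lcvg w (Gw : G w) := decay_cvg0 (L0 w) p0 r0 Gw.
have GX w : G w -> is_compact_real_tree
    (limit_space beta (xi w) (fun m i => copy m i w) (fun m => enum m w)).
  move=> Gw; have [C [rho [C0 rho0 rho1 Lle]]] := Lgeo w Gw.
  by apply: (@limit_compact_real_tree _ _ _ _ _ _ C rho) => //; exact: Lcvg.
exists (limit_tree GX); split.
  apply: random_limit_tree => //.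
  - by move=> n; exact: measurable_before_all.
  by move=> w x e _; exact: limit_rational_code_dense.
(* [Z] is nonnegative with finite expectation, hence almost everywhere finite. *)
have : (\forall w \ae P, G w).
  have iZ : P.-integrable setT Z.
    apply/integrableP; split => //; under eq_integral do rewrite gee0_abs//.
    exact: Zoo.
  apply: filterS (integrable_ae measurableT iZ) => w /(_ I) wZ.
  by rewrite /G/= -ge0_fin_numE.
apply: filterS => w Gw; split; first by move=> n; apply: stage_compact_real_tree; exact: Lcvg.
rewrite limit_treeE//; have [C [rho [C0 rho0 rho1 Lle]]] := Lgeo w Gw.
apply: (@squeeze_cvge _ _ _ _ (cst 0%E) _ (fun n => ((C / (1 - rho) + 1) * rho ^+ n)%:E)).
- by apply: nearW => n; rewrite gh_dist_ge0 /=; apply: gh_dist_stage => //; exact: Lcvg.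
- exact: cvg_cst.
apply: cvg_EFin; first by apply: nearW.
rewrite -[X in _ --> X](mulr0 (C / (1 - rho) + 1)).
by apply: cvgM; [exact: cvg_cst|apply: cvg_expr; rewrite gtr0_norm].
Qed.
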